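(* Let the covariates $Z_1,\dots,Z_N$, the function $h=(h_1,\dots,h_p)$, the functions $f_1,\dots,f_N$, the set $D_0$, the integer $m\ge0$, the constants $F_m,F_{m+1},d_j,\sigma_0$ and the noise variables $\omega_1,\dots,\omega_N$ be as in the Gaussian setting described in the context (Regularity, Parameter Domain and Gaussian assumptions). Fix an arbitrary $\theta\in D_0$. Then there is a process $\{\xi(v):v\in D_0\}$ such that for $v\in D_0$, $$\sum_{i=1}^N\omega_if_i(h(Z_i)^\top v)=\sum_{k=0}^m\frac1{k!}\Big(\sum_{i=1}^N\omega_if_i^{(k)}(h(Z_i)^\top\theta)[h(Z_i)^\top(v-\theta)]^k\Big)+\xi(v)\Big(\sum_{j=1}^pd_j|v_j-\theta_j|\Big)^m$$ $$=\sum_{k=0}^m\frac1{k!}\Big(\sum_{i=1}^N\omega_if_i^{(k)}(h(Z_i)^\top\theta)\,h(Z_i)^{\otimes k}\Big)^\top(v-\theta)^{\otimes k}+\xi(v)\Big(\sum_{j=1}^pd_j|v_j-\theta_j|\Big)^m,$$ and $$\Pr\Big\{\sup_{v\in D_0}|\xi(v)|>\sigma_0\big(A\sqrt{\ln(2p)}+B\sqrt{2\ln(p^m/q)}\big)\Big\}\le q,\qquad\forall q\in(0,1),$$ where, with $$R=\sup_{u,v\in D_0}\sum_{j=1}^p d_j|u_j-v_j|,\qquad \phi=\min\Big(\frac{2F_m}{m!},\frac{F_{m+1}R}{(m+1)!}\Big),\qquad \psi=\begin{cases}F_{m+1}/m!& m\ne1\\ F_{m+1}/2& m=1,\end{cases}$$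 one sets $$A=8\psi R\sqrt{\max_{j\le p}\sum_{i=1}^N[h_j(Z_i)/d_j]^2},\qquad B=\phi\sqrt{\max_{j\le p}\sum_{i=1}^N[h_j(Z_i)/d_j]^{2m}},$$ with the convention $x^0\equiv1$ in the definition of $B$ when $m=0$.
   Context: Setting. $Z_1,\dots,Z_N\in\mathcal Z$ are fixed (nonrandom), $h=(h_1,\dots,h_p):\mathcal Z\to\mathbb R^p$ is a measurable function, and $Y_i=\mu_i-\omega_i$, where the $\mu_i$ are unknown constants and $\omega_1,\dots,\omega_N$ are independent mean-zero square-integrable random variables. $f_1,\dots,f_N:\mathbb R\to\mathbb R$ are given functions, and the loss functions are $\gamma_i(t,Y_i)=(Y_i-f_i(t))^2/2$ (so that $\sum_i\omega_i[f_i(h(Z_i)^\top v)-f_i(h(Z_i)^\top\theta)]$ is the difference of the centered total empirical losses at $v$ and $\theta$). Put $d_j=\max_{i\le N}|h_j(Z_i)|$, assumed positive for all $j\le p$. Regularity assumption. There are $m\in\{0,1,2,\dots\}$ and $-\infty\le a_i<b_i\le\infty$, $i\le N$, such that each $f_i$ is $m$ times differentiable on $(a_i,b_i)$ with the $m$-th derivative $f_i^{(m)}$ bounded and Lipschitz there. $F_m=\max_{i\le N}\sup_{t\in(a_i,b_i)}|f_i^{(m)}(t)|$ and $F_{m+1}=\max_{i\le N}\|f_i^{(m)}\|_{\rm Lip}$, where $\|f\|_{\rm Lip}=\sup_{x\ne y}|f(x)-f(y)|/|x-y|$ over $(a_i,b_i)$. Parameter Domain assumption. $D_0\subset\mathbb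 R^p$ is a nonempty set with $h(Z_i)^\top v\in(a_i,b_i)$ for all $v\in D_0$, $i\le N$. Gaussian assumption. $\omega_1,\dots,\omega_N$ are independent (mean-zero) Gaussian variables with $\mathrm{Var}(\omega_i)\le\sigma_0^2$, $i\le N$, where $\sigma_0\in(0,\infty)$ is a constant. Notation. For $a\in\mathbb R^m,b\in\mathbb R^n$, $a\otimes b=(a_1b^\top,\dots,a_mb^\top)^\top\in\mathbb R^{mn}$, and $v^{\otimes k}$ is the tensor product of $k$ copies of $v$ ($v^{\otimes0}=1$). Convention $0\cdot\infty=0$ if $F_{m+1}=0$ and $R=\infty$. *)

(* Defs.v *)
From HB Require Import structures.
From mathcomp Require Import all_boot all_order all_algebra.
From mathcomp Require Import all_classical all_reals all_analysis.
From mathcomp Require Export mxtens.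

Set Implicit Arguments.
Unset Strict Implicit.
Unset Printing Implicit Defensive.

Import Order.TTheory GRing.Theory Num.Theory.
Import numFieldNormedType.Exports.

Local Open Scope classical_set_scope.
Local Open Scope ring_scope.

Definition dotv {R : realType} {n : nat} (u v : 'cV[R]_n) : R :=
  (u^T *m v) 0 0.

(* [v ^t k] has [1 ^ k] columns, and [1 ^ k] is not convertible to [1]. *)
Definition tensor_pow {R : realType} {n : nat} (v : 'cV[R]_n) (k : nat) :
    'cV[R]_(n ^ k) :=
  castmx (erefl (n ^ k)%N, exp1n k) (v ^t k).

Definition eoo {R : realType} (a b : \bar R) : set R :=
  [set t | (a < t%:E < b)%E].

Definition times_differentiable_on {R : realType} (m : nat) (I : set R)
    (f : R -> R) : Prop :=
  forall k, (k < m)%N -> forall t, I t -> derivable (f^`(k)%classic) t 1.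

Definition mutually_independent {d : measure_display} {T : measurableType d}
    {R : realType} (P : probability T R) {I : finType}
    (X : I -> {RV P >-> R}) : Prop :=
  forall (J : {set I}) (A : I -> set R),
    (forall i, i \in J -> measurable (A i)) ->
    P (\bigcap_(i in [set` J]) (X i @^-1` A i)) =
    (\prod_(i in J) P (X i @^-1` A i))%E.

(* [normal_prob mu 0] is the uniform law on [0, 1], so the degenerate Gaussian
   has to be given separately as a point mass. *)
Definition gaussian_rv {d : measure_display} {T : measurableType d}
    {R : realType} (P : probability T R) (X : {RV P >-> R}) : Prop :=
  exists mu s : R, 0 <= s /\
    forall A : set R, measurable A ->
      distribution P X A =
      if s == 0 then dirac mu A else normal_prob mu s A.

Definition sup_norm_on {R : realType} (I : set R) (g : R -> R) : \bar R :=
  ereal_sup [set (`|g t|)%:E | t in I].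

Definition lip_norm_on {R : realType} (I : set R) (g : R -> R) : \bar R :=
  ereal_sup [set (`|g z.1 - g z.2| / `|z.1 - z.2|)%:E
            | z in [set z : R * R | [/\ I z.1, I z.2 & z.1 != z.2]]].

Section constants.
Context {R : realType} {N p : nat}.

Definition Fbound (m : nat) (I : 'I_N -> set R) (f : 'I_N -> R -> R) : \bar R :=
  \big[maxe/-oo%E]_(i < N) sup_norm_on (I i) ((f i)^`(m)%classic).

Definition Flip (m : nat) (I : 'I_N -> set R) (f : 'I_N -> R -> R) : \bar R :=
  \big[maxe/-oo%E]_(i < N) lip_norm_on (I i) ((f i)^`(m)%classic).

(* Below, [x i] stands for the vector h(Z_i). *)
Implicit Type x : 'I_N -> 'cV[R]_p.

Definition scale x (j : 'I_p) : R :=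
  \big[Num.max/0]_(i < N) `|x i j 0|.

Definition wl1 x (u v : 'cV[R]_p) : R :=
  \sum_(j < p) scale x j * `|u j 0 - v j 0|.

Definition wl1_diam x (D : set 'cV[R]_p) : \bar R :=
  ereal_sup [set (wl1 x z.1 z.2)%:E | z in D `*` D].

(* Only used with [k] even, where the sums are nonnegative. *)
Definition scaled_moment x (k : nat) : R :=
  \big[Num.max/0]_(j < p) \sum_(i < N) (x i j 0 / scale x j) ^+ k.

Local Open Scope ereal_scope.

(* In these products [0 * +oo = 0]. *)
Definition phi (m : nat) (I : 'I_N -> set R) (f : 'I_N -> R -> R) x
    (D : set 'cV[R]_p) : \bar R :=
  mine (2%:E * Fbound m I f / (m`!%:R)%:E)
       (Flip m I f * wl1_diam x D / (m.+1`!%:R)%:E).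

Definition psi (m : nat) (I : 'I_N -> set R) (f : 'I_N -> R -> R) : \bar R :=
  if m == 1%N then Flip m I f / 2%:E else Flip m I f / (m`!%:R)%:E.

Definition Aconst (m : nat) (I : 'I_N -> set R) (f : 'I_N -> R -> R) x
    (D : set 'cV[R]_p) : \bar R :=
  8%:E * psi m I f * wl1_diam x D * (Num.sqrt (scaled_moment x 2))%:E.

Definition Bconst (m : nat) (I : 'I_N -> set R) (f : 'I_N -> R -> R) x
    (D : set 'cV[R]_p) : \bar R :=
  phi m I f x D * (Num.sqrt (scaled_moment x (2 * m)))%:E.

Definition threshold (m : nat) (I : 'I_N -> set R) (f : 'I_N -> R -> R) x
    (D : set 'cV[R]_p) (sigma0 q : R) : \bar R :=
  sigma0%:E *
  (Aconst m I f x D * (Num.sqrt (ln ((2 * p)%:R)))%:E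
   + Bconst m I f x D * (Num.sqrt (2 * ln (p%:R ^+ m / q)))%:E).

End constants.

(* Main.v *)
Require Import Defs.
From HB Require Import structures.
From mathcomp Require Import all_boot all_order all_algebra.
From mathcomp Require Import all_classical all_reals all_analysis.
From mathcomp Require Import measurable_realfun ring lra.
Set Implicit Arguments.
Unset Strict Implicit.
Unset Printing Implicit Defensive.
Import Order.TTheory GRing.Theory Num.Theory.
Import numFieldNormedType.Exports.
Local Open Scope classical_set_scope.
Local Open Scope ring_scope.

(** Write [x_i] for the covariate vectors, [s_i = <x_i, theta>], and [rho_i(v)]
    for the Taylor remainder of order [m] of [f_i] at [s_i], evaluated at
    [<x_i, v>] and divided by [<x_i, v - theta>^m].  Wherever the weight
    [sum_j d_j |v_j - theta_j|] does not vanish the identity leaves no choice for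
    [xi(v)], so everything is in the deviation bound.

    _From the process to linear forms._  Put [e_ji = x_ij / d_j] and
    [u_j = d_j (v_j - theta_j)]; then [<x_i, v - theta> = sum_j e_ji u_j] and the
    weight is [sum_j |u_j|].  Expanding the [m]-th power of that sum over
    multi-indices [J] exhibits [xi(v)] as a combination, with coefficients of total
    mass at most one, of the Gaussian linear forms
    [sum_i omega_i rho_i(v) prod_l e_(J_l) i] ([xi_le_multi]).  A union bound over
    the [p^m] multi-indices turns [1/q] into [p^m/q], and it remains to control each
    family of linear forms, indexed by [v], for a fixed [J] ([exceed_prob]).

    _Size of the coefficients._  The quotient [rho_i] is bounded by [phi], and as a
    function of [<x_i, v>] it is Lipschitz with constant [lip_quot m F], at most
    [2 psi] ([taylor_quot_bound], [taylor_quot_lip]).  Since [|e_ji| <= 1], the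
    linear forms inherit both bounds, and by the arithmetic-geometric inequality
    their variances are at most [sigma0^2 phi^2] times the scaled moment of order
    [2 m].

    _Mean of the supremum._  For a centred law, symmetric under [x |-> - x], the
    coefficients may be replaced by a dominating Lipschitz image one coordinate at
    a time without decreasing the mean of the maximum ([contraction]).  The
    dominating forms are linear in [u], hence bounded by [sum_j |u_j|] times the
    maximum of [2 p] Gaussian variables, whose mean is of order [sqrt(ln(2 p))]
    ([maximal_abs]).

    _Deviation above twice that mean._  The bound requires the exact factor
    [exp(- r^2 / (2 sigma^2 V))], with [V] the largest variance.  It comes from the
    dual form of the Gaussian transport inequality: if
    [h(x) <= f(y) + (x - y)^2 / (2 sigma^2)] then
    [E exp(l h) <= exp(l E f)] for [0 < l < 1].  In dimension one this follows from
    a level-set form of the Prekopa-Leindler inequality ([prekopa_min],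
    [normal_transport]), and it passes to product laws one coordinate at a time
    ([transport_chain]).  Applied to a maximum of linear forms, for which the
    infimal convolution with the quadratic cost is explicit, it bounds the
    exponential moment of the penalised maximum ([gaussian_max_mgf]); Markov's
    inequality followed by [l -> 1] gives [finite_deviation].

    _From finite to arbitrary index sets._  For a fixed [w], [xi(v)(w)] is linear in
    a vector of [R^N] depending on [v], so a sequence dense for these vectors
    describes the event exactly ([exceed_seq]); this gives measurability and reduces
    the bound to finite families by monotone limits. *)

(** * One-dimensional Brunn-Minkowski and Prekopa-Leindler inequalities *)
Section brunn_minkowski.
Context {R : realType}.
Notation mu := (@lebesgue_measure R).
Notation GR := (measurableTypeR R).

Lemma measurable_superlevel (f : R -> R) (s : R) : measurable_fun setT f ->
  measurable [set x | s <= f x].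
Proof.
move=> mf; have : measurable_fun setT (fun x : R => s <= f x).
  exact: measurable_fun_ler.
by move=> /(_ measurableT [set true]); rewrite setTI; exact.
Qed.

(** Truncating at height 1 keeps only the levels in [0, 1], which are the ones
    compared in [prekopa_min]; the identity is Fubini for the region under the graph. *)
Lemma layer_cake1 (u : R -> R) : measurable_fun setT u -> (forall x, 0 <= u x) ->
  (\int[mu]_x (Num.min (u x) 1)%:E =
   \int[mu]_(s in `]0%R, 1%R]) mu [set x | (s <= u x)%R])%E.
Proof.
move=> mu_ u0.
pose A : set (GR * GR) := [set p | 0 < p.2 <= Num.min (u p.1) 1].
have mA : measurable A.
  have -> : A = (fun p : GR * GR => (0 < p.2)) @^-1` [set true] `&`
     (fun p : GR * GR => (p.2 <= Num.min (u p.1) 1)) @^-1` [set true].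
    by apply/seteqP; split => p; rewrite /A /=; [move=> /andP[-> ->]|move=> [-> ->]].
  apply: measurableI.
  - have : measurable_fun setT (fun p : GR * GR => (0 < p.2)).
      exact: measurable_fun_ltr.
    by move=> /(_ measurableT [set true]); rewrite setTI; exact.
  - have : measurable_fun setT (fun p : GR * GR => (p.2 <= Num.min (u p.1) 1)).
      apply: measurable_fun_ler => //.
      by apply: measurable_minr => //; exact: (measurableT_comp mu_).
    by move=> /(_ measurableT [set true]); rewrite setTI; exact.
have E := @fubini_tonelli _ _ GR GR R mu mu (fun p => (\1_A p)%:E).
transitivity (\int[mu]_x fubini_F mu (fun p : GR * GR => (\1_A p)%:E) x)%E;
    last rewrite E; last 2 first.
- exact/measurable_EFinP/measurable_indic.
- by move=> x; rewrite lee_fin.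
- apply: eq_integral => x _; rewrite /fubini_F.
  have -> : (fun y => (\1_A (x, y))%:E) =
      (fun y => (\1_(`]0, Num.min (u x) 1]%classic : set GR) y)%:E :> \bar R).
    by apply/funext => y; rewrite /A !indicE !mem_setE/= in_itv.
  rewrite (@integral_indic _ _ _ mu setT measurableT _ (measurable_itv _)) setIT.
  rewrite [RHS](lebesgue_measure_itv `]0%R, Num.min (u x) 1%R])/= lte_fin.
  case: ifPn => [_|]; first by rewrite oppr0 adde0.
  rewrite -leNgt => h; congr EFin; apply/eqP; rewrite eq_le h/=.
  by rewrite le_min u0 ler01.
- rewrite [RHS]integral_mkcond; apply: eq_integral => s _.
  rewrite /fubini_G patchE; case: ifPn => [|sN].
    rewrite mem_setE in_itv/= => /andP[s0 s1].
    have -> : (fun y => (\1_A (y, s))%:E) =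
        (fun y => (\1_([set x | s <= u x] : set GR) y)%:E :> \bar R).
      apply/funext => y; rewrite /A !indicE; congr ((_ (_ : bool))%:R%:E).
      by apply/idP/idP => /set_mem/= h; apply/mem_set => /=; move: h; rewrite s0 le_min s1 andbT.
    have mB : measurable ([set x | s <= u x] : set GR) by exact: measurable_superlevel.
    by rewrite (@integral_indic _ _ _ mu setT measurableT _ mB) setIT.
  apply: integral0_eq => x _; rewrite indicE memNset; first by [].
  rewrite /A/= le_min => /andP[s0 /andP[_ s1]].
  by move: sN; rewrite mem_setE in_itv/= s0 s1.
Qed.

(** The set is the image of [A] under [x |-> c x + d]; its measure is found by
    uniqueness of the Lebesgue measure on half-open intervals. *)
Lemma lebesgue_measure_affine (c d : R) (A : set R) : 0 < c -> measurable A ->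
  mu [set z | A ((z - d) / c)] = (c%:E * mu A)%E.
Proof.
move=> c0 mA.
pose f : GR -> GR := fun z => (z - d) / c.
have mf : measurable_fun setT f.
  by apply: measurable_funM => //; apply: measurable_funB.
pose ci : {nonneg R} := NngNum (ltW (etrans (invr_gt0 c) c0)).
have [pf pfE] : exists pf : {measure set GR -> \bar R},
    forall B, pf B = mu (f @^-1` B).
  unshelve eexists.
    by unshelve eapply (pushforward mu f : {measure set GR -> \bar R}); exact: mf.
  by [].
have -> : mu A = mscale ci pf A.
  apply: lebesgue_measure_unique => //= _ [[a b] _ <-].
  rewrite /mscale/= pfE.
  have -> : f @^-1` `]a, b] = `]c * a + d, c * b + d]%classic.
    apply/seteqP; split => z /=; rewrite /f !in_itv/= ltr_pdivlMr// ler_pdivrMr//;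
    by rewrite ltrBrDr lerBlDr ![_ * c]mulrC.
  rewrite !lebesgue_measure_itv/= !lte_fin ltrD2r ltr_pM2l//.
  case: ifPn => _; last by rewrite mule0.
  rewrite -!EFinD -EFinM; congr EFin; by field; rewrite gt_eqF.
by rewrite /mscale/= pfE muleA -EFinM divff ?gt_eqF// mul1e.
Qed.

Lemma closed_sup_mem (A : set R) (K : R) : A !=set0 -> closed A ->
  (forall x, A x -> `|x| <= K) ->
  exists2 a, A a & forall x, A x -> x <= a.
Proof.
move=> A0 cA AK.
have uA : has_ubound A by exists K => x /AK; apply: le_trans; exact: ler_norm.
exists (sup A).
  by have := closure_sup A0 uA; rewrite -(closure_id A).1.
by move=> x Ax; apply: sup_upper_bound.
Qed.

Lemma closed_inf_mem (A : set R) (K : R) : A !=set0 -> closed A ->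
  (forall x, A x -> `|x| <= K) ->
  exists2 a, A a & forall x, A x -> a <= x.
Proof.
move=> [a0 Aa0] cA AK.
have [||x|a Aa ha] := @closed_sup_mem [set - x | x in A] K.
- by exists (- a0), a0.
- exact: closedN.
- by move=> [y Ay <-]; rewrite normrN; exact: AK.
- case: Aa => y Ay ya; exists y => // x Ax.
  by rewrite -lerN2 ya; apply: ha; exists x.
Qed.

(** Translate so that the supremum of [A] and the infimum of [B] meet: the two
    translates sit inside [C] and overlap in at most one point. *)
Lemma brunn_minkowski1 (l K : R) (A B C : set R) : 0 < l < 1 ->
  A !=set0 -> B !=set0 -> closed A -> closed B -> measurable C ->
  (forall x, A x -> `|x| <= K) -> (forall x, B x -> `|x| <= K) ->
  (forall x y, A x -> B y -> C ((1 - l) * x + l * y)) ->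
  ((1 - l)%:E * mu A + l%:E * mu B <= mu C)%E.
Proof.
move=> /andP[l0 l1] A0 B0 cA cB mC AK BK ABC.
have l1' : 0 < 1 - l by rewrite subr_gt0.
have [a Aa ha] := closed_sup_mem A0 cA AK.
have [b Bb hb] := closed_inf_mem B0 cB BK.
have mA : measurable A by exact: closed_measurable.
have mB : measurable B by exact: closed_measurable.
have mS (c d : R) (D : set R) : measurable D -> measurable [set z : R | D ((z - d) / c)].
  move=> mD; rewrite -[X in measurable X]setTI.
  have mf : measurable_fun setT (fun z : R => (z - d) / c).
    by apply: measurable_funM => //; apply: measurable_funB.
  exact: mf.
(* the only point that the two translates can share *)
set q := (1 - l) * a + l * b.
have := lebesgue_measure_affine (l * b) l1' mA.
set A' := [set z | _] => <-.
have := lebesgue_measure_affine ((1 - l) * a) l0 mB.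
set B' := [set z | _] => <-.
have mA' : measurable A' by exact: mS.
have mB' : measurable B' by exact: mS.
have mq : mu (A' `&` B') = 0%E.
  apply/eqP; rewrite -measure_le0 -(lebesgue_measure_set1 q).
  apply: le_measure; rewrite ?inE//; first exact: measurableI.
  move=> z [/ha + /hb]; rewrite ler_pdivrMr// ler_pdivlMr// /q !lerBlDr => h1 h2.
  by apply/eqP; rewrite /= eq_le; apply/andP; split; [move: h1|move: h2]; rewrite ?lerBrDr; lra.
have -> : mu A' = mu (A' `\` B').
  rewrite (measureDI mu mA' mB') -[RHS]adde0; congr (_ + _)%E; exact: mq.
rewrite -measureU//; last 2 first.
- exact: measurableD.
- by apply/seteqP; split => // z [[]].
apply: le_measure; rewrite ?inE//.
  by apply: measurableU => //; exact: measurableD.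
move=> z [[/= Az _]|/= Bz].
- have := ABC _ _ Az Bb; rewrite mulrC divfK ?gt_eqF//.
  by rewrite subrK.
- have := ABC _ _ Aa Bz; rewrite [l * _]mulrC divfK ?gt_eqF//.
  by rewrite subrKC.
Qed.

(** At each level [s] in [0, 1] the superlevel sets of [u] and [v] are nonempty,
    because both functions attain 1, so the Brunn-Minkowski inequality applies to
    them and can be integrated over [s].  Nonemptiness is what allows an arithmetic
    mean of the integrals where the general Prekopa-Leindler inequality has a
    geometric one. *)
Lemma prekopa_min (l : R) (u v w : R -> R) : 0 < l < 1 ->
  continuous u -> continuous v -> measurable_fun setT w ->
  (forall x, 0 <= u x <= 1) -> (forall x, 0 <= v x <= 1) -> (forall x, 0 <= w x) ->
  (exists x, u x = 1) -> (exists x, v x = 1) ->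
  (forall s, 0 < s -> exists K, forall x, s <= u x -> `|x| <= K) ->
  (forall s, 0 < s -> exists K, forall x, s <= v x -> `|x| <= K) ->
  (forall x y, Num.min (u x) (v y) <= w ((1 - l) * x + l * y)) ->
  ((1 - l)%:E * \int[mu]_x (u x)%:E + l%:E * \int[mu]_x (v x)%:E
   <= \int[mu]_x (w x)%:E)%E.
Proof.
move=> l01 cu cv mw u01 v01 w0 [xu uxu] [xv vxv] Ku Kv uvw.
have /andP[l0 l1] := l01.
have cS (f : R -> R) s : continuous f -> closed [set x | s <= f x].
  move=> cf; apply: (@closed_comp _ _ f [set y | s <= y]); last exact: closed_ge.
  by move=> x _; exact: cf.
have muE (f : R -> R) : (forall x, 0 <= f x <= 1) ->
    (\int[mu]_x (f x)%:E = \int[mu]_x (Num.min (f x) 1)%:E)%E.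
  by move=> f01; apply: eq_integral => x _; rewrite min_l//; have /andP[] := f01 x.
have mu_ : measurable_fun setT u by exact: continuous_measurable_fun.
have mv_ : measurable_fun setT v by exact: continuous_measurable_fun.
have u0 x : 0 <= u x by have /andP[] := u01 x.
have v0 x : 0 <= v x by have /andP[] := v01 x.
apply: (@le_trans _ _ (\int[mu]_x (Num.min (w x) 1)%:E)%E); last first.
  apply: ge0_le_integral => //.
  - by move=> x _; rewrite lee_fin le_min w0 ler01.
  - by apply/measurable_EFinP; exact: measurable_minr.
  - by apply/measurable_EFinP.
  - by move=> x _; rewrite lee_fin ge_min lexx.
rewrite (muE u u01) (muE v v01) (layer_cake1 mu_ u0) (layer_cake1 mv_ v0) (layer_cake1 mw w0).
have mL (f : R -> R) : measurable_fun setT f ->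
    measurable_fun (`]0, 1]%classic : set GR) (fun s => mu [set x | s <= f x]).
  move=> mf; apply: measurable_funTS.
  have mA : measurable ([set p : GR * GR | p.2 <= f p.1]).
    have : measurable_fun setT (fun p : GR * GR => p.2 <= f p.1).
      by apply: measurable_fun_ler => //; exact: (measurableT_comp mf).
    by move=> /(_ measurableT [set true]); rewrite setTI; exact.
  apply: eq_measurable_fun (measurable_fun_ysection mu mA) => s _ /=.
  by congr (mu _); apply/seteqP; split => x; rewrite /ysection /= inE.
rewrite -ge0_integralZl; [|by []|exact: mL|by []|by rewrite lee_fin subr_ge0 ltW].
rewrite -ge0_integralZl; [|by []|exact: mL|by []|by rewrite lee_fin ltW].
rewrite -ge0_integralD; [|by []|..]; last 4 first.
- by move=> s _; apply: mule_ge0 => //; rewrite lee_fin subr_ge0 ltW.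
- apply: measurable_funeM; exact: mL.
- by move=> s _; apply: mule_ge0 => //; rewrite lee_fin ltW.
- apply: measurable_funeM; exact: mL.
apply: ge0_le_integral => //.
- by move=> s _; apply: adde_ge0; apply: mule_ge0 => //; rewrite lee_fin ltW // subr_gt0.
- by apply: emeasurable_funD; apply: measurable_funeM; exact: mL.
- exact: mL.
move=> s; rewrite /= in_itv/= => /andP[s0 s1].
have [K1 HK1] := Ku _ s0; have [K2 HK2] := Kv _ s0.
apply: (@brunn_minkowski1 _ (Num.max K1 K2)) => //.
- by exists xu; rewrite /= uxu.
- by exists xv; rewrite /= vxv.
- exact: cS.
- exact: cS.
- exact: measurable_superlevel.
- by move=> x /HK1 h; rewrite le_max h.
- by move=> x /HK2 h; rewrite le_max h orbT.
- move=> x y /= sx sy; apply: le_trans (uvw x y).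
  by rewrite le_min sx sy.
Qed.

End brunn_minkowski.

(** * The transport inequality for a normal law *)
Section gaussian.
Context {R : realType}.
Notation mu := (@lebesgue_measure R).
Notation GR := (measurableTypeR R).

Lemma lip_continuous (L : R) (f : R -> R) :
  (forall x y, f x <= f y + L * `|x - y|) -> continuous f.
Proof.
move=> fL x; apply/cvgrPdist_le => e e0; near=> y.
have M0 : 0 < `|L| + 1 by rewrite ltr_wpDl.
have : `|x - y| <= e / (`|L| + 1).
  near: y; apply: cvgr_dist_le; [exact: cvg_id | exact: divr_gt0].
rewrite ler_pdivlMr// => h.
have hL : L * `|x - y| <= e.
  apply: le_trans h; rewrite mulrC; apply: ler_wpM2l => //.
  by rewrite (le_trans (ler_norm L))// lerDl.
rewrite ler_norml; apply/andP; split.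
  by have := fL y x; rewrite distrC; lra.
by have := fL x y; lra.
Unshelve. all: by end_near. Qed.

Lemma expR_convex2 (l p q : R) : 0 <= l <= 1 ->
  expR ((1 - l) * p + l * q) <= (1 - l) * expR p + l * expR q.
Proof.
move=> /andP[l0 l1]; set c := _ + _.
have tan z : expR c * (1 + (z - c)) <= expR z.
  have -> : expR z = expR c * expR (z - c) by rewrite -expRD subrKC.
  by apply: ler_wpM2l; [exact: expR_ge0|exact: expR_ge1Dx].
have hq := ler_wpM2l l0 (tan q).
have l1' : 0 <= 1 - l by rewrite subr_ge0.
have hp := ler_wpM2l l1' (tan p).
apply: le_trans (lerD hp hq); rewrite le_eqVlt; apply/orP; left.
by apply/eqP; rewrite /c; ring.
Qed.

(** A quadratic penalty beats linear growth: such functions attain their maximum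
    and have bounded superlevel sets, as [prekopa_min] requires. *)
Section coercive.
Variables (a : R -> R) (C L s : R).
Hypotheses (s0 : 0 < s) (ca : continuous a).
Hypothesis aC : forall x, a x <= C + L * `|x| - x ^+ 2 / (s ^+ 2 *+ 2).

Lemma coercive_bounded (c : R) : exists K, forall x, c <= a x -> `|x| <= K.
Proof.
set t := s ^+ 2 *+ 2.
have t0 : 0 < t by rewrite /t mulrn_wgt0// exprn_gt0.
exists (t * (`|L| + `|C - c|) + 1) => x cx; rewrite leNgt; apply/negP => Kx.
have x1 : 1 <= `|x|.
  have : 0 <= t * (`|L| + `|C - c|).
    by apply: mulr_ge0; [exact: ltW|exact: addr_ge0].
  by move: Kx; lra.
have := le_trans cx (aC x); apply/negP; rewrite -ltNge.
have : t * (`|L| + `|C - c|) * `|x| < x ^+ 2.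
  rewrite -(real_normK (num_real x)) expr2 ltr_pM2r; last exact: lt_le_trans x1.
  by move: Kx; lra.
rewrite -mulrA mulrC -ltr_pdivlMr// -/t => h.
have hL : L * `|x| <= `|L| * `|x| by apply: ler_wpM2r => //; exact: ler_norm.
have hC : C - c <= `|C - c| * `|x|.
  by rewrite (le_trans (ler_norm _))// ler_peMr.
move: h; rewrite mulrDl; lra.
Qed.

Lemma coercive_max : exists x0, forall x, a x <= a x0.
Proof.
have [K HK] := coercive_bounded (a 0).
have K0 : 0 <= K by rewrite -(normr0 R); exact: HK.
have [||c cA cm] := @EVT_max R a (- K) K.
- by lra.
- by apply: continuous_subspaceT.
exists c => x; case: (leP `|x| K) => [xK|].
  by apply: cm; rewrite in_itv/= -ler_norml.
move=> Kx; apply: le_trans (cm 0 _); last by rewrite in_itv/=; lra.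
by rewrite leNgt; apply/negP => /ltW/HK; rewrite leNgt Kx.
Qed.

End coercive.

Lemma normal_pdf0E (s x : R) : 0 < s ->
  normal_pdf 0 s x = normal_peak s * expR (- x ^+ 2 / (s ^+ 2 *+ 2)).
Proof. by move=> s0; rewrite normal_pdfE ?gt_eqF// /normal_fun subr0. Qed.

Lemma measurable_lip (L : R) (f : R -> R) :
  (forall x y, f x <= f y + L * `|x - y|) -> measurable_fun setT f.
Proof. by move=> fL; apply: continuous_measurable_fun; exact: lip_continuous fL. Qed.

(** This is the dual (Bobkov-Gotze) form of Talagrand's transport inequality.  The
    exponents [a = l h - x^2/t] and [b = - (1 - l) f - x^2/t], with [t = 2 s^2],
    satisfy [(1 - l) a(x) + l b(y) <= - ((1 - l) x + l y)^2 / t] by the hypothesis on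
    [h] and [f].  After division by their maxima, [exp a] and [exp b] are covered by
    [prekopa_min]; convexity of [expR] trades the resulting arithmetic mean for the
    geometric mean of the integrals of [exp(l h)] and [exp(- (1 - l) f)] against the
    normal density, and Jensen's inequality bounds the second one below by
    [exp(- (1 - l) m)]. *)
Lemma normal_transport (s l L m : R) (f h : R -> R) : 0 < s -> 0 < l < 1 ->
  (forall x y, f x <= f y + L * `|x - y|) ->
  (forall x y, h x <= h y + L * `|x - y|) ->
  (forall x, 0 <= f x) ->
  (forall x y, h x <= f y + (x - y) ^+ 2 / (s ^+ 2 *+ 2)) ->
  (\int[mu]_x (f x * normal_pdf 0 s x)%:E = m%:E)%E ->
  (\int[mu]_x (expR (l * h x) * normal_pdf 0 s x)%:E <= (expR (l * m))%:E)%E.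
Proof.
move=> s0 l01 fL hL f0 hf fm; have /andP[l0 l1] := l01.
have l1' : 0 < 1 - l by rewrite subr_gt0.
have t0 : 0 < s ^+ 2 *+ 2 by rewrite mulrn_wgt0// exprn_gt0.
set t := s ^+ 2 *+ 2 in t0 hf *.
have cf := lip_continuous fL; have ch := lip_continuous hL.
have mf := measurable_lip fL; have mh := measurable_lip hL.
have mpdf := measurable_normal_pdf 0 s.
have pdf0 x : 0 <= normal_pdf 0 s x by exact: normal_pdf_ge0.
have k0 : 0 < normal_peak s by rewrite normal_peak_gt0 ?gt_eqF.
set k := normal_peak s in k0.
pose a x := l * h x - x ^+ 2 / t.
pose b x := - ((1 - l) * f x) - x ^+ 2 / t.
have cq : continuous (fun x : R => x ^+ 2 / t).
  by move=> x; apply: cvgM; [exact: exprn_continuous|exact: cvg_cst].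
have ca : continuous a.
  by move=> x; apply: cvgB; [apply: cvgM; [exact: cvg_cst|exact: ch]|exact: cq].
have cb : continuous b.
  by move=> x; apply: cvgB; [apply: cvgN; apply: cvgM; [exact: cvg_cst|exact: cf]|exact: cq].
have aC x : a x <= l * h 0 + l * L * `|x| - x ^+ 2 / (s ^+ 2 *+ 2).
  rewrite /a lerD2r -mulrA -mulrDr; apply: ler_wpM2l; first exact: ltW.
  by have := hL x 0; rewrite subr0.
have bC x : b x <= 0 + 0 * `|x| - x ^+ 2 / (s ^+ 2 *+ 2).
  by rewrite /b lerD2r mul0r addr0 oppr_le0 mulr_ge0// ltW.
have [xa maxa] := coercive_max s0 ca aC.
have [xb maxb] := coercive_max s0 cb bC.
set al := a xa in maxa; set be := b xb in maxb.
pose u x := expR (a x - al); pose v x := expR (b x - be).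
pose w z := expR (- z ^+ 2 / t - (1 - l) * al - l * be).
have mexp (g : R -> R) : continuous g -> continuous (fun x => expR (g x)).
  by move=> cg x; apply: continuous_comp; [exact: cg|exact: continuous_expR].
have key : ((1 - l)%:E * \int[mu]_x (u x)%:E + l%:E * \int[mu]_x (v x)%:E
   <= \int[mu]_x (w x)%:E)%E.
  apply: (prekopa_min l01).
  - by apply: mexp => x; apply: cvgB; [exact: ca|exact: cvg_cst].
  - by apply: mexp => x; apply: cvgB; [exact: cb|exact: cvg_cst].
  - apply: continuous_measurable_fun; apply: mexp => x.
    apply: cvgB; last exact: cvg_cst.
    apply: cvgB; last exact: cvg_cst.
    by apply: cvgM; [apply: cvgN; exact: exprn_continuous|exact: cvg_cst].
  - by move=> x; rewrite expR_ge0/= -expR0 ler_expR subr_le0 maxa.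
  - by move=> x; rewrite expR_ge0/= -expR0 ler_expR subr_le0 maxb.
  - by move=> x; exact: expR_ge0.
  - by exists xa; rewrite /u subrr expR0.
  - by exists xb; rewrite /v subrr expR0.
  - move=> c c0; have [K HK] := coercive_bounded s0 aC (ln c + al).
    by exists K => x; rewrite /u -[c in c <= _](lnK c0) ler_expR => ?; apply: HK; rewrite -lerBrDr.
  - move=> c c0; have [K HK] := coercive_bounded s0 bC (ln c + be).
    by exists K => x; rewrite /v -[c in c <= _](lnK c0) ler_expR => ?; apply: HK; rewrite -lerBrDr.
  - move=> x y; have ab : (1 - l) * (a x - al) + l * (b y - be) <=
        - ((1 - l) * x + l * y) ^+ 2 / t - (1 - l) * al - l * be.
      have := ler_wpM2l (ltW (mulr_gt0 l0 l1')) (hf x y).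
      rewrite -subr_ge0 => h1; rewrite -subr_ge0; apply: le_trans h1 _.
      by rewrite le_eqVlt /a /b; apply/orP; left; apply/eqP;
        clear -t0; clearbody t; field; rewrite gt_eqF.
    case: (leP (a x - al) (b y - be)) => h1.
      rewrite ge_min; apply/orP; left; rewrite /u /w ler_expR; apply: le_trans ab.
      by have := ler_wpM2l (ltW l0) h1; lra.
    rewrite ge_min; apply/orP; right; rewrite /v /w ler_expR; apply: le_trans ab.
    by have := ler_wpM2l (ltW l1') (ltW h1); lra.
have mu_ : measurable_fun setT u.
  by apply: continuous_measurable_fun; apply: mexp => x; apply: cvgB; [exact: ca|exact: cvg_cst].
have mv_ : measurable_fun setT v.
  by apply: continuous_measurable_fun; apply: mexp => x; apply: cvgB; [exact: cb|exact: cvg_cst].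
have u0 x : 0 <= u x by exact: expR_ge0.
have v0 x : 0 <= v x by exact: expR_ge0.
have UE : (\int[mu]_x (expR (l * h x) * normal_pdf 0 s x)%:E =
    (k * expR al)%:E * \int[mu]_x (u x)%:E)%E.
  rewrite -ge0_integralZl; [| by [] | exact/measurable_EFinP | by move=> x _; rewrite lee_fin
    | by rewrite lee_fin mulr_ge0 ?expR_ge0// ltW].
  apply: eq_integral => x _; rewrite -EFinM normal_pdf0E// -/t -/k /u /a; congr EFin.
  by rewrite mulrCA -mulrA -!expRD; congr (k * expR _); lra.
have VE : (\int[mu]_x (expR (- ((1 - l) * f x)) * normal_pdf 0 s x)%:E =
    (k * expR be)%:E * \int[mu]_x (v x)%:E)%E.
  rewrite -ge0_integralZl; [| by [] | exact/measurable_EFinP | by move=> x _; rewrite lee_fin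
    | by rewrite lee_fin mulr_ge0 ?expR_ge0// ltW].
  apply: eq_integral => x _; rewrite -EFinM normal_pdf0E// -/t -/k /v /b; congr EFin.
  by rewrite mulrCA -mulrA -!expRD; congr (k * expR _); lra.
set W := expR (- (1 - l) * al - l * be).
have WE : (\int[mu]_x (w x)%:E = (k^-1 * W)%:E)%E.
  rewrite -[RHS]mule1 -(integral_normal_pdf 0 s).
  rewrite -ge0_integralZl; [| by [] | exact/measurable_EFinP | by move=> x _; rewrite lee_fin
    | by rewrite lee_fin mulr_ge0 ?expR_ge0// invr_ge0 ltW].
  apply: eq_integral => x _; rewrite -EFinM normal_pdf0E// -/t -/k /w /W; congr EFin.
  rewrite [RHS]mulrACA mulVf ?gt_eqF// mul1r -expRD; congr expR; lra.
have J : ((expR (- ((1 - l) * m)))%:E <=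
    \int[mu]_x (expR (- ((1 - l) * f x)) * normal_pdf 0 s x)%:E)%E.
  set g := fun x => expR (- ((1 - l) * f x)) * normal_pdf 0 s x.
  set c := expR (- ((1 - l) * m)).
  have c0 : 0 < c by exact: expR_gt0.
  have g0 x : 0 <= g x by rewrite mulr_ge0 ?expR_ge0.
  have mg : measurable_fun setT g.
    apply: measurable_funM => //; apply: measurableT_comp => //.
    by apply: measurableT_comp => //; exact: measurable_funM.
  have fp0 x : 0 <= f x * normal_pdf 0 s x by rewrite mulr_ge0.
  have mfp : measurable_fun setT (fun x => f x * normal_pdf 0 s x) by exact: measurable_funM.
  have : ((c * (1 + (1 - l) * m))%:E <= \int[mu]_x (g x)%:E + (c * (1 - l) * m)%:E)%E.
    have m0 : 0 <= m.
      by rewrite -lee_fin -fm; apply: integral_ge0 => x _; rewrite lee_fin.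
    rewrite [in leRHS]EFinM -[in leRHS]fm.
    rewrite -ge0_integralZl; [| by [] | exact/measurable_EFinP | by move=> x _; rewrite lee_fin
      | by rewrite lee_fin mulr_ge0// ltW].
    rewrite -ge0_integralD; [| by [] | by move=> x _; rewrite lee_fin | exact/measurable_EFinP
      | by move=> x _; rewrite lee_fin !mulr_ge0// ltW
      | by apply/measurable_EFinP; exact: measurable_funM].
    rewrite -[leLHS]mule1 -(integral_normal_pdf 0 s).
    rewrite -ge0_integralZl; [| by [] | exact/measurable_EFinP | by move=> x _; rewrite lee_fin
      | by rewrite lee_fin mulr_ge0// ?addr_ge0 ?mulr_ge0// ltW].
    apply: ge0_le_integral => //.
    - by move=> x _; rewrite lee_fin !mulr_ge0// ?addr_ge0 ?mulr_ge0// ltW.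
    - by apply/measurable_EFinP; exact: measurable_funM.
    - apply: emeasurable_funD; first exact/measurable_EFinP.
      by apply/measurable_EFinP; exact: measurable_funM.
    move=> x _; rewrite -EFinD lee_fin /g mulrA -mulrDl; apply: ler_wpM2r => //.
    have -> : expR (- ((1 - l) * f x)) = c * expR ((1 - l) * m - (1 - l) * f x).
      by rewrite /c -expRD; congr expR; lra.
    rewrite -mulrA -mulrDr; apply: ler_wpM2l; first exact: ltW.
    have := expR_ge1Dx ((1 - l) * m - (1 - l) * f x); lra.
  have -> : c * (1 + (1 - l) * m) = c + c * (1 - l) * m by ring.
  by rewrite EFinD leeD2rE.
rewrite UE; rewrite VE in J; rewrite WE in key.
have iu0 : (0 <= \int[mu]_x (u x)%:E)%E by apply: integral_ge0 => x _; rewrite lee_fin.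
have iv0 : (0 <= \int[mu]_x (v x)%:E)%E by apply: integral_ge0 => x _; rewrite lee_fin.
move: iu0 iv0 key J.
case: (\int[mu]_x (u x)%:E)%E => [U| |//]; last first.
  move=> _; case: (\int[mu]_x (v x)%:E)%E => [V| |//] _.
    by move=> K _; exfalso; move: K; rewrite gt0_muley ?lte_fin// -EFinM addye// leye_eq.
  by move=> K _; exfalso; move: K; rewrite !gt0_muley ?lte_fin// addye// leye_eq.
case: (\int[mu]_x (v x)%:E)%E => [V| |//]; last first.
  by move=> _ _ K _; exfalso; move: K; rewrite [(l%:E * _)%E]gt0_muley ?lte_fin//
    -EFinM addey// leye_eq.
rewrite -!EFinM -EFinD !lee_fin => U0 V0 key J.
rewrite leNgt; apply/negP => Ulm.
have kW : (1 - l) * (k * U) + l * (k * V) <= W.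
  by move: (ler_wpM2l (ltW k0) key); rewrite mulrA mulfV ?gt_eqF// mul1r; lra.
have h1 : expR (l * m - al) < k * U.
  by rewrite expRD expRN ltr_pdivrMr ?expR_gt0// mulrAC.
have h2 : expR (- ((1 - l) * m) - be) <= k * V.
  by rewrite [X in X <= _]expRD [expR (- be)]expRN ler_pdivrMr ?expR_gt0// mulrAC.
have h3 : (1 - l) * expR (l * m - al) + l * expR (- ((1 - l) * m) - be) < W.
  apply: lt_le_trans kW; apply: ltr_leD; first by rewrite ltr_pM2l.
  by apply: ler_wpM2l => //; exact: ltW.
have l01' : 0 <= l <= 1 by rewrite !ltW.
have h4 := expR_convex2 (l * m - al) (- ((1 - l) * m) - be) l01'.
have := le_lt_trans h4 h3; rewrite /W.
by rewrite [X in expR X < _](_ : _ = - (1 - l) * al - l * be) ?ltxx//; ring.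
Qed.

End gaussian.

(** * Centred Gaussian random variables *)
Section transfer.
Context {R : realType}.
Notation mu := (@lebesgue_measure R).
Local Open Scope ereal_scope.

(** The density is recovered from the Radon-Nikodym derivative of the law, with
    which it agrees almost everywhere. *)
Lemma ge0_integral_normal_prob (m s : R) (f : R -> \bar R) :
  measurable_fun setT f -> (forall x, 0 <= f x) ->
  \int[normal_prob m s]_x f x = \int[mu]_x (f x * (normal_pdf m s x)%:E).
Proof.
move=> mf f0.
have dom := normal_prob_dominates m s.
rewrite -(Radon_Nikodym_SigmaFinite.change_of_variables dom f0 measurableT mf).
have iRN := Radon_Nikodym_SigmaFinite.f_integrable dom.
apply: ae_eq_integral => //.
- by apply: emeasurable_funM => //; exact: measurable_int iRN.
- apply: emeasurable_funM => //; apply/measurable_EFinP; exact: measurable_normal_pdf.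
- apply: ae_eqe_mul2l => /=.
  apply: integral_ae_eq => //.
  + by apply/measurable_EFinP; exact: measurable_normal_pdf.
  + by move=> E _ mE; rewrite -Radon_Nikodym_SigmaFinite.f_integral.
Qed.

End transfer.

Section gaussian_rv.
Context {d : measure_display} {T : measurableType d} {R : realType}.
Variable P : probability T R.
Notation mu := (@lebesgue_measure R).
Local Open Scope ereal_scope.

Definition gaussian_law (m s : R) (X : {RV P >-> R}) : Prop :=
  forall A : set R, measurable A ->
    distribution P X A = if s == 0%R then dirac m A else normal_prob m s A.

Lemma ge0_integral_gaussian (m s : R) (X : {RV P >-> R}) (f : R -> \bar R) :
  gaussian_law m s X -> measurable_fun setT f -> (forall x, 0 <= f x) ->
  \int[P]_w f (X w) =
    if s == 0%R then f m else \int[mu]_x (f x * (normal_pdf m s x)%:E).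
Proof.
move=> gX mf f0.
(* the law of [X], seen on the Borel structure that carries the Lebesgue measure *)
have mX : measurable_fun setT (X : T -> measurableTypeR R).
  exact: (measurable_funP X : measurable_fun setT (X : T -> R)).
have E := @ge0_integral_pushforward _ _ T (measurableTypeR R) R X mX P setT f
  measurableT mf (fun x _ => f0 x).
rewrite preimage_setT in E; rewrite -[LHS]E.
move: gX; rewrite /gaussian_law; case: ifPn => _ gX.
  rewrite (eq_measure_integral (dirac (m : measurableTypeR R))) => [|A mA _]; last exact: gX.
  by rewrite integral_dirac// diracT mul1e.
rewrite (eq_measure_integral (normal_prob m s)) => [|A mA _]; last exact: gX.
exact: ge0_integral_normal_prob.
Qed.

Lemma gaussian_mgf (m s t : R) (X : {RV P >-> R}) : gaussian_law m s X ->
  \int[P]_w (expR (t * X w))%:E = (expR (t * m + t ^+ 2 * s ^+ 2 / 2))%:E.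
Proof.
move=> gX.
rewrite (ge0_integral_gaussian (f := fun x => (expR (t * x))%:E) gX) => [||x]; last 2 first.
- by apply/measurable_EFinP; apply: measurableT_comp => //; exact: mulrl_measurable.
- by rewrite lee_fin expR_ge0.
case: ifPn => [/eqP->|s0]; first by rewrite expr0n/= mulr0 mul0r addr0.
rewrite -[RHS]mule1 -(integral_normal_pdf (m + t * s ^+ 2) s).
rewrite -ge0_integralZl; [| by [] | apply/measurable_EFinP; exact: measurable_normal_pdf
  | by move=> x _; rewrite lee_fin normal_pdf_ge0 | by rewrite lee_fin expR_ge0].
apply: eq_integral => x _; rewrite -!EFinM !normal_pdfE// mulrCA [in RHS]mulrCA /normal_fun.
by rewrite -!expRD; congr (_ * expR _)%:E; field.
Qed.

(** Taking means in [1 + t X <= exp(t X)] gives [t m + t^2 s^2 / 2 >= 0] for every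
    real [t], which is impossible near 0 unless [m = 0]. *)
Lemma gaussian_mean0 (m s : R) (X : {RV P >-> R}) : gaussian_law m s X ->
  P.-integrable setT (EFin \o X) -> \int[P]_w (X w)%:E = 0 -> m = 0%R.
Proof.
move=> gX iX X0.
have key t : (0 <= t * m + t ^+ 2 * s ^+ 2 / 2)%R.
  rewrite -ler_expR expR0 -lee_fin -(gaussian_mgf t gX).
  have -> : 1%:E = \int[P]_w (1 + t * X w)%:E :> \bar R.
    under eq_integral do rewrite EFinD EFinM.
    rewrite integralD//; last 2 first.
    - exact: finite_measure_integrable_cst.
    - exact: integrableZl.
    by rewrite integralZl// X0 mule0 adde0 integral_cst// mul1e; exact/esym/probability_setT.
  apply: le_integral => //.
  - under eq_fun do rewrite EFinD EFinM.
    apply: integrableD => //; first exact: finite_measure_integrable_cst.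
    exact: integrableZl.
  - apply/integrableP; split.
      apply/measurable_EFinP; apply: measurableT_comp => //; exact: measurable_funM.
    under eq_integral do rewrite gee0_abs ?lee_fin ?expR_ge0//.
    by rewrite (gaussian_mgf t gX) ltry.
  - by move=> w _; rewrite lee_fin expR_ge1Dx.
apply/eqP/negPn/negP => m0.
have m2 : (0 < m ^+ 2)%R by rewrite exprn_even_gt0.
have := key (- m / (s ^+ 2 + 1))%R.
have s1 : (0 < s ^+ 2 + 1)%R by rewrite ltr_wpDl// sqr_ge0.
have -> : (- m / (s ^+ 2 + 1) * m + (- m / (s ^+ 2 + 1)) ^+ 2 * s ^+ 2 / 2 =
  - (m ^+ 2 / (s ^+ 2 + 1) ^+ 2 * (s ^+ 2 / 2 + 1)))%R by field; rewrite gt_eqF.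
rewrite oppr_ge0 leNgt => /negP; apply.
have q0 : (0 <= s ^+ 2)%R by exact: sqr_ge0.
by apply: mulr_gt0; [apply: divr_gt0 => //; exact: exprn_gt0|lra].
Qed.

(** A lower bound for the second moment at every scale below [s], obtained without
    integrating [x^2]: for the [c] that turns scale [s] into scale [s'], the mean of
    [exp(- c X^2)] is [s' / s], and it is at least [1 - c V]. *)
Lemma gaussian_second_moment (s s' V : R) (X : {RV P >-> R}) : gaussian_law 0 s X ->
  (0 < s' < s)%R -> \int[P]_w ((X w) ^+ 2)%:E = V%:E -> (s' ^+ 2 <= V)%R.
Proof.
move=> gX /andP[s'0 s's] XV.
have s0 : (0 < s)%R := lt_trans s'0 s's.
pose c := ((s ^+ 2 - s' ^+ 2) / (2 * s ^+ 2 * s' ^+ 2))%R.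
have c0 : (0 < c)%R.
  rewrite divr_gt0// ?mulr_gt0 ?exprn_gt0// subr_gt0.
  by rewrite ltr_pXn2r// nnegrE ltW.
have E : \int[P]_w (expR (- (c * (X w) ^+ 2)))%:E = (s' / s)%:E.
  rewrite (ge0_integral_gaussian (f := fun x => (expR (- (c * x ^+ 2)))%:E) gX)
    => [||x]; last 2 first.
  - apply/measurable_EFinP; apply: measurableT_comp => //.
    apply: measurableT_comp => //; apply: measurable_funM => //; exact: exprn_measurable.
  - by rewrite lee_fin expR_ge0.
  rewrite gt_eqF//.
  rewrite -[RHS]mule1 -(integral_normal_pdf 0 s').
  rewrite -ge0_integralZl; [| by [] | apply/measurable_EFinP; exact: measurable_normal_pdf
    | by move=> x _; rewrite lee_fin normal_pdf_ge0 | by rewrite lee_fin divr_ge0 ?ltW].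
  apply: eq_integral => x _; rewrite -!EFinM !normal_pdf0E//; congr EFin.
  have peakE r : (0 < r)%R -> normal_peak r = (r^-1 * (Num.sqrt (pi *+ 2))^-1)%R.
    move=> r0; rewrite /normal_peak -mulrnAr sqrtrM ?sqr_ge0// sqrtr_sqr gtr0_norm//.
    by rewrite invfM.
  rewrite !peakE// mulrCA -expRD [RHS]mulrA; congr (_ * expR _)%R.
    by field; rewrite !gt_eqF// sqrtr_gt0 mulrn_wgt0// pi_gt0.
  by rewrite /c; field; rewrite !gt_eqF.
have iX2 : P.-integrable setT (fun w => ((X w) ^+ 2)%:E).
  apply/integrableP; split.
    by apply/measurable_EFinP; apply: measurable_funX.
  under eq_integral do rewrite gee0_abs ?lee_fin ?sqr_ge0//.
  by rewrite XV ltry.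
have : (1 - c * V)%:E <= \int[P]_w (expR (- (c * (X w) ^+ 2)))%:E.
  have -> : (1 - c * V)%:E = \int[P]_w (1%:E + (- c)%:E * ((X w) ^+ 2)%:E).
    rewrite integralD//; last 2 first.
    - exact: finite_measure_integrable_cst.
    - exact: integrableZl.
    rewrite integralZl// XV integral_cst// mul1e [X in X + _]probability_setT.
    by rewrite -EFinM -EFinD mulNr.
  apply: le_integral => //.
  - apply: integrableD => //; first exact: finite_measure_integrable_cst.
    exact: integrableZl.
  - apply/integrableP; split.
      apply/measurable_EFinP; apply: measurableT_comp => //.
      apply: measurableT_comp => //; apply: measurable_funM => //; exact: measurable_funX.
    under eq_integral do rewrite gee0_abs ?lee_fin ?expR_ge0//.
    by rewrite E ltry.
  - by move=> w _; rewrite -EFinM -EFinD lee_fin mulNr expR_ge1Dx.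
rewrite E lee_fin => h.
have : ((s - s') / s <= c * V)%R.
  by have -> : ((s - s') / s = 1 - s' / s)%R; [field; rewrite gt_eqF|lra].
have -> : ((s - s') / s = c * (2 * s * s' ^+ 2 / (s + s')))%R.
  by rewrite /c; field; rewrite !gt_eqF// addr_gt0.
rewrite ler_pM2l// => h2; apply: le_trans h2.
rewrite ler_pdivlMr ?addr_gt0// [leRHS]mulrC.
by apply: ler_wpM2l; [exact: sqr_ge0|lra].
Qed.

(** Bounding the scale, instead of fixing it, lets one [sigma] serve for all the noise
    variables. *)
Definition centered_gaussian (sigma : R) (X : {RV P >-> R}) : Prop :=
  exists s : R, (0 <= s <= sigma)%R /\ gaussian_law 0 s X.

(** If the scale exceeded [sigma], then [gaussian_second_moment] at the midpoint of
    the two would contradict the bound on the variance. *)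
Lemma gaussian_rv_centered (sigma : R) (X : {RV P >-> R}) : (0 < sigma)%R ->
  gaussian_rv X -> (X : T -> R) \in Lfun P 2%:E -> 'E_P[X] = 0 ->
  (variance P X <= (sigma ^+ 2)%:E)%E -> centered_gaussian sigma X.
Proof.
move=> sig0 [m [s [s0 gX]]] X2 EX VX.
have X1 : (X : T -> R) \in Lfun P 1 by rewrite Lfun_subset12 ?fin_num_measure.
have m0 : m = 0%R.
  apply: (gaussian_mean0 gX); first exact/Lfun1_integrable.
  by rewrite -expectation_def.
rewrite {}m0 in gX; exists s; split => //; rewrite s0/= leNgt; apply/negP => ss.
have iX2 : P.-integrable setT (fun w => ((X w) ^+ 2)%:E) := Lfun2_integrable_sqr X2.
have VE : \int[P]_w ((X w) ^+ 2)%:E = (fine (\int[P]_w ((X w) ^+ 2)%:E))%:E.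
  by rewrite fineK// integrable_fin_num.
have h2 : (((s + sigma) / 2) ^+ 2 <= fine (\int[P]_w ((X w) ^+ 2)%:E))%R.
  by apply: (gaussian_second_moment gX) => //; lra.
have h1 : (fine (\int[P]_w ((X w) ^+ 2)%:E) <= sigma ^+ 2)%R.
  by move: VX; rewrite varianceE// EX expe2 mule0 sube0 unlock -lee_fin -VE.
have : (((s + sigma) / 2) ^+ 2 <= sigma ^+ 2)%R := le_trans h2 h1.
by rewrite ler_pXn2r// ?nnegrE; lra.
Qed.

Section centered.
Variables (sigma : R) (X : {RV P >-> R}).
Hypotheses (sigma0 : (0 < sigma)%R) (gX : centered_gaussian sigma X).

Lemma centered_mgf (t : R) :
  \int[P]_w (expR (t * X w))%:E <= (expR (t ^+ 2 * sigma ^+ 2 / 2))%:E.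
Proof.
have [s [/andP[s0 ss] gs]] := gX.
rewrite (gaussian_mgf t gs) lee_fin ler_expR mulr0 add0r.
apply: ler_wpM2r => //; apply: ler_wpM2l; first exact: sqr_ge0.
by rewrite ler_pXn2r// nnegrE ltW.
Qed.

Lemma centered_integrable : P.-integrable setT (EFin \o X).
Proof.
have mX : measurable_fun setT X by exact: measurable_funP.
have mE t : measurable_fun setT (fun w => (expR (t * X w))%:E).
  apply/measurable_EFinP; apply: measurableT_comp => //; exact: measurable_funM.
apply/integrableP; split; first exact/measurable_EFinP.
apply: (@le_lt_trans _ _ (\int[P]_w ((expR (1 * X w))%:E + (expR (-1 * X w))%:E))).
  apply: ge0_le_integral => //.
  - by apply: measurableT_comp => //; exact/measurable_EFinP.
  - by apply: emeasurable_funD.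
  - move=> w _; rewrite -EFinD lee_fin mul1r mulN1r.
    have := expR_ge1Dx (X w); have := expR_ge1Dx (- X w).
    have := expR_gt0 (X w); have := expR_gt0 (- X w).
    by case: (lerP 0 (X w)) => h; [rewrite ger0_norm//|rewrite ltr0_norm//]; lra.
rewrite ge0_integralD//.
by rewrite lte_add_pinfty// (le_lt_trans (centered_mgf _))// ltry.
Qed.

Lemma centered_sym (f : R -> \bar R) : measurable_fun setT f ->
  (forall x, 0 <= f x) -> \int[P]_w f (X w) = \int[P]_w f (- X w)%R.
Proof.
move=> mf f0; have [s [/andP[s0 ss] gs]] := gX.
have mfN : measurable_fun setT (fun x : R => f (- x)%R) by exact: measurableT_comp.
rewrite (ge0_integral_gaussian gs mf f0).
rewrite (ge0_integral_gaussian (f := fun x : R => f (- x)%R) gs mfN) => [|x]; last exact: f0.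
case: ifPn => sN; first by rewrite oppr0.
pose g (x : R) := f x * (normal_pdf 0 s x)%:E.
have mg : measurable_fun setT g.
  by apply: emeasurable_funM => //; apply/measurable_EFinP; exact: measurable_normal_pdf.
have g0 x : 0 <= g x by rewrite mule_ge0// lee_fin normal_pdf_ge0.
have mN : measurable_fun setT (-%R : measurableTypeR R -> measurableTypeR R).
  exact: (@oppr_measurable R setT).
have := @ge0_integral_pushforward _ _ (measurableTypeR R) (measurableTypeR R) R -%R mN mu setT g
  measurableT mg (fun x _ => g0 x).
rewrite preimage_setT => E.
transitivity (\int[mu]_x (g \o -%R) x); last first.
  apply: eq_integral => x _; rewrite /g/=; congr (_ * _%:E).
  by rewrite !normal_pdfE// /normal_fun !subr0 sqrrN.
rewrite -E; apply: eq_measure_integral => A mA _.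
exact/esym/lebesgue_measureN.
Qed.

Lemma centered_transport (l L m : R) (f h : R -> R) : (0 < l < 1)%R ->
  (forall x y, f x <= f y + L * `|x - y|)%R ->
  (forall x y, h x <= h y + L * `|x - y|)%R ->
  (forall x, 0 <= f x)%R ->
  (forall x y, h x <= f y + (x - y) ^+ 2 / (sigma ^+ 2 *+ 2))%R ->
  \int[P]_w (f (X w))%:E = m%:E ->
  \int[P]_w (expR (l * h (X w)))%:E <= (expR (l * m))%:E.
Proof.
move=> l01 fL hL f0 hf fm; have [s [/andP[s0 ss] gs]] := gX.
have mf : measurable_fun setT (EFin \o f).
  by apply/measurable_EFinP; exact: measurable_lip fL.
have mh : measurable_fun setT (fun x => (expR (l * h x))%:E).
  apply/measurable_EFinP; apply: measurableT_comp => //.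
  by apply: measurable_funM => //; exact: measurable_lip hL.
move: fm; rewrite (ge0_integral_gaussian gs mf) => [|x]; last by rewrite /= lee_fin.
rewrite (ge0_integral_gaussian gs mh) => [|x]; last by rewrite lee_fin expR_ge0.
have /andP[l0 l1] := l01.
case: ifPn => [_ [<-]|sN fm].
  rewrite lee_fin ler_expR; apply: ler_wpM2l; first exact: ltW.
  by have := hf 0%R 0%R; rewrite subr0 expr0n/= mul0r addr0.
have {}s0 : (0 < s)%R by rewrite lt_neqAle eq_sym sN.
have := normal_transport s0 l01 fL hL f0 _ fm.
move=> /(_ _)/le_trans -> //.
move=> x y; apply: (le_trans (hf x y)); rewrite lerD2l.
apply: ler_wpM2l; first exact: sqr_ge0.
by rewrite lef_pV2 ?posrE ?mulrn_wgt0 ?exprn_gt0// ler_wMn2r// ler_pXn2r// nnegrE ltW.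
Qed.

End centered.

End gaussian_rv.

(** * Independent copies of some of the coordinates *)
Section independence.
Context {d : measure_display} {T : measurableType d} {R : realType}.
Variable P : probability T R.
Variables (N : nat) (om : 'I_N -> {RV P >-> R}).
Hypothesis om_indep : mutually_independent om.
Local Open Scope ereal_scope.

Definition rvec (w : T) : N.-tuple R := [tuple om i w | i < N].

(** With [w] and [w'] independent, [mix S w w'] redraws the coordinates outside
    [S]. *)
Definition mix (S : {set 'I_N}) (w w' : T) : N.-tuple R :=
  [tuple if i \in S then om i w else om i w' | i < N].

Lemma measurable_rvec : measurable_fun setT rvec.
Proof.
apply/measurable_fun_tnthP => i.
rewrite (_ : _ \o _ = om i); last by apply/funext => w /=; rewrite tnth_mktuple.
exact: measurable_funP.
Qed.

Lemma measurable_mix (S : {set 'I_N}) :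
  measurable_fun setT (fun p : T * T => mix S p.1 p.2).
Proof.
apply/measurable_fun_tnthP => i.
case: (boolP (i \in S)) => iS.
  rewrite (_ : _ \o _ = om i \o fst); last by apply/funext => w /=; rewrite tnth_mktuple iS.
  by apply: measurableT_comp => //; exact: measurable_funP.
rewrite (_ : _ \o _ = om i \o snd); last first.
  by apply/funext => w /=; rewrite tnth_mktuple (negbTE iS).
by apply: measurableT_comp => //; exact: measurable_funP.
Qed.

Definition rect (A : 'I_N -> set R) : set (N.-tuple R) :=
  [set t | forall i, A i (tnth t i)].

Lemma measurable_rect (A : 'I_N -> set R) : (forall i, measurable (A i)) ->
  measurable (rect A).
Proof.
move=> mA.
have -> : rect A = \bigcap_(i in [set: 'I_N]) ((fun t => tnth t i) @^-1` A i).
  by apply/seteqP; split => t /= h; [move=> i _; exact: h|move=> i; exact: h].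
apply: fin_bigcap_measurable => // i _.
by rewrite -[X in measurable X]setTI; exact: measurable_tnth.
Qed.

(** The product sigma-algebra is generated by rectangles, a class stable under
    intersection. *)
Lemma measurable_rectE : @measurable _ (N.-tuple R) =
  <<s [set rect A | A in [set A | forall i, measurable (A i)]] >>.
Proof.
apply/seteqP; split; last first.
  apply: smallest_sub; first exact: sigma_algebra_measurable.
  by move=> _ [A mA <-]; exact: measurable_rect.
apply: smallest_sub; first exact: smallest_sigma_algebra.
move=> B; rewrite -bigcup_seq/= => -[i _ [A mA <-]].
apply: sub_sigma_algebra.
exists (fun j => if j == i then A else setT).
  by move=> j; case: ifP.
apply/seteqP; split => t /=.
  by move=> /(_ i); rewrite eqxx.
by move=> [_ At] j; case: ifP => // /eqP ->.
Qed.

(** On rectangles both sides factor, by independence, into the same product over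
    the coordinates in and outside [S]; rectangles determine a probability. *)
Lemma rvec_mix_measure (S : {set 'I_N}) (B : set (N.-tuple R)) : measurable B ->
  P (rvec @^-1` B) = (P \x P) ((fun p => mix S p.1 p.2) @^-1` B).
Proof.
move=> mB.
have [m1 m1E] : exists m : {measure set (N.-tuple R) -> \bar R},
    forall B, m B = P (rvec @^-1` B).
  unshelve eexists.
    by unshelve eapply (pushforward P rvec : {measure set _ -> \bar R}); exact: measurable_rvec.
  by [].
have [m2 m2E] : exists m : {measure set (N.-tuple R) -> \bar R},
    forall B, m B = (P \x P) ((fun p => mix S p.1 p.2) @^-1` B).
  unshelve eexists.
    unshelve eapply (pushforward (P \x P) (fun p => mix S p.1 p.2)
      : {measure set _ -> \bar R}); exact: measurable_mix.
  by [].
rewrite -m1E -m2E.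
apply: (measure_unique [set rect A | A in [set A | forall i, measurable (A i)]] (fun=> setT)) => //.
- exact: measurable_rectE.
- move=> _ _ [A mA <-] [A' mA' <-]; exists (fun i => A i `&` A' i).
    by move=> i; exact: measurableI.
  by apply/seteqP; split => t /=; [move=> h; split => i; have [] := h i|move=> [h h'] i; split].
- move=> _; exists (fun=> setT) => //.
  by apply/seteqP; split.
- by rewrite bigcup_const.
- move=> _ [A mA <-]; rewrite m1E m2E.
  pose rS (J : {set 'I_N}) := \bigcap_(i in [set` J]) (om i @^-1` A i).
  have -> : rvec @^-1` rect A = rS [set: 'I_N]%SET.
    apply/seteqP; split => w /= h.
      by move=> i _; have := h i; rewrite tnth_mktuple.
    by move=> i; rewrite tnth_mktuple; apply: h => /=; rewrite inE.
  have -> : (fun p : T * T => mix S p.1 p.2) @^-1` rect A = rS S `*` rS (~: S)%SET.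
    apply/seteqP; split => w /= h.
      split=> i /= iS; have := h i; rewrite tnth_mktuple ?iS//.
      by move: iS; rewrite inE => /negbTE ->.
    move=> i; rewrite tnth_mktuple; case: ifPn => iS; first exact: h.1.
    by apply: h.2 => /=; rewrite inE.
  have mrS J : measurable (rS J).
    apply: fin_bigcap_measurable => // i _.
    by rewrite -[X in measurable X]setTI; exact: measurable_funP.
  rewrite product_measure1E// {1}/rS om_indep//.
  rewrite (bigID (mem S))/=; congr (_ * _).
    by rewrite /rS om_indep//; apply: eq_bigl => i; rewrite inE.
  by rewrite /rS om_indep//; apply: eq_bigl => i; rewrite !inE.
- by move=> _; rewrite m1E preimage_setT [P _]probability_setT ltry.
Qed.

(** The form in which independence is used from here on: the coordinates outside
    [S] may be integrated out first, the others being held fixed. *)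
Lemma ge0_integral_mix (S : {set 'I_N}) (F : N.-tuple R -> \bar R) :
  measurable_fun setT F -> (forall t, 0 <= F t) ->
  \int[P]_w F (rvec w) = \int[P]_w \int[P]_w' F (mix S w w').
Proof.
move=> mF F0.
have E1 := @ge0_integral_pushforward _ _ _ _ R rvec measurable_rvec P setT F
  measurableT mF (fun x _ => F0 x).
have E2 := @ge0_integral_pushforward _ _ _ _ R (fun p => mix S p.1 p.2) (measurable_mix S) (P \x P)
  setT F measurableT mF (fun x _ => F0 x).
rewrite preimage_setT in E1; rewrite preimage_setT in E2.
rewrite -[LHS]E1.
have -> : \int[P]_w \int[P]_w' F (mix S w w') =
    \int[P \x P]_p (F \o (fun p => mix S p.1 p.2)) p.
  rewrite fubini_tonelli1; [by []| |by move=> p; exact: F0].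
  by apply: measurableT_comp => //; exact: measurable_mix.
refine (etrans _ E2); apply: eq_measure_integral.
- exact: measurable_mix.
- exact: measurable_rvec.
- by move=> /= _ _ B mB _; exact: rvec_mix_measure.
Qed.

End independence.

(** * Transport inequality for independent coordinates *)
Section freeze.
Context {R : realType} {N : nat}.

(** One operation serves both to change a single coordinate and to glue two vectors
    together. *)
Definition freeze (b : pred 'I_N) (c : 'I_N -> R) (x : N.-tuple R) : N.-tuple R :=
  [tuple if b i then c i else tnth x i | i < N].

Lemma tnth_freeze b c x i : tnth (freeze b c x) i = if b i then c i else tnth x i.
Proof. by rewrite tnth_mktuple. Qed.

Lemma measurable_freeze b c : measurable_fun setT (freeze b c).
Proof.
apply/measurable_fun_tnthP => i; case: (boolP (b i)) => bi.
  rewrite (_ : _ \o _ = cst (c i)); first exact: measurable_cst.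
  by apply/funext => x /=; rewrite tnth_freeze bi.
rewrite (_ : _ \o _ = fun x => tnth x i); first exact: measurable_tnth.
by apply/funext => x /=; rewrite tnth_freeze (negbTE bi).
Qed.

(** Membership in this class is inherited by partial means and guarantees that all
    of them are finite. *)
Definition l1lip (L : R) (F : N.-tuple R -> R) :=
  [/\ measurable_fun setT F, (forall x, 0 <= F x) &
    forall x y, F x <= F y + \sum_(i < N) L * `|tnth x i - tnth y i|].

Lemma l1lip_freeze L F b c : 0 <= L -> l1lip L F -> l1lip L (F \o freeze b c).
Proof.
move=> L0 [mF F0 FL]; split => [|x|x y].
- by apply: measurableT_comp => //; exact: measurable_freeze.
- exact: F0.
- apply: le_trans (FL _ (freeze b c y)) _; rewrite /= lerD2l; apply: ler_sum => i _.
  rewrite !tnth_freeze; case: ifP => // _.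
  by rewrite subrr normr0 mulr0 mulr_ge0.
Qed.

Lemma l1lip_upd L F (k : 'I_N) (x : N.-tuple R) : 0 <= L -> l1lip L F ->
  forall u v, F (freeze (pred1 k) (fun=> u) x) <=
              F (freeze (pred1 k) (fun=> v) x) + L * `|u - v|.
Proof.
move=> L0 [mF F0 FL] u v.
apply: le_trans (FL _ (freeze (pred1 k) (fun=> v) x)) _; rewrite lerD2l.
rewrite (bigD1 k)//= !tnth_freeze/= eqxx big1 ?addr0// => i ik.
by rewrite !tnth_freeze/= (negbTE ik) subrr normr0 mulr0.
Qed.

End freeze.

Section chain.
Context {d : measure_display} {T : measurableType d} {R : realType}.
Variable P : probability T R.
Variables (N : nat) (om : 'I_N -> {RV P >-> R}) (sigma : R).
Hypothesis om_indep : mutually_independent om.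
Hypothesis sigma0 : 0 < sigma.
Hypothesis om_gauss : forall i, centered_gaussian sigma (om i).
Local Open Scope ereal_scope.
Notation rvec := (rvec om).
Notation upd x k u := (freeze (pred1 k) (fun=> u) x).

Lemma ge0_integral_upd (k : 'I_N) (F : N.-tuple R -> \bar R) :
  measurable_fun setT F -> (forall t, 0 <= F t) ->
  \int[P]_w F (rvec w) = \int[P]_w \int[P]_w' F (upd (rvec w) k (om k w')).
Proof.
move=> mF F0; rewrite (ge0_integral_mix om_indep (~: [set k]%SET) mF F0).
apply: eq_integral => w _; apply: eq_integral => w' _; congr F.
apply: eq_from_tnth => i; rewrite tnth_freeze !tnth_mktuple !inE/=.
by case: eqVneq => //= ->.
Qed.

Lemma ge0_integral_updC (k : 'I_N) (F : N.-tuple R -> \bar R) :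
  measurable_fun setT F -> (forall t, 0 <= F t) ->
  \int[P]_w F (rvec w) = \int[P]_w' \int[P]_w F (upd (rvec w) k (om k w')).
Proof.
move=> mF F0; rewrite (ge0_integral_mix om_indep [set k]%SET mF F0).
apply: eq_integral => w _; apply: eq_integral => w' _; congr F.
apply: eq_from_tnth => i; rewrite tnth_freeze !tnth_mktuple !inE/=.
by case: eqVneq => //= ->.
Qed.

Lemma measurable_upd_integral (k : 'I_N) (F : N.-tuple R -> \bar R) :
  measurable_fun setT F -> (forall t, 0 <= F t) ->
  measurable_fun setT (fun w => \int[P]_w' F (upd (rvec w) k (om k w'))).
Proof.
move=> mF F0.
have mp : measurable_fun setT (fun p : T * T => F (upd (rvec p.1) k (om k p.2))).
  apply: measurableT_comp => //; apply/measurable_fun_tnthP => i.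
  case: (eqVneq i k) => ik.
    rewrite (_ : _ \o _ = om k \o snd); last first.
      by apply/funext => x /=; rewrite tnth_freeze/= ik eqxx.
    by apply: measurableT_comp => //; exact: measurable_funP.
  rewrite (_ : _ \o _ = om i \o fst); last first.
    by apply/funext => x /=; rewrite tnth_freeze/= (negbTE ik) tnth_mktuple.
  by apply: measurableT_comp => //; exact: measurable_funP.
exact: (@measurable_fun_fubini_tonelli_F _ _ _ _ R P _ mp).
Qed.

Definition mean (F : N.-tuple R -> R) : R := fine (\int[P]_w (F (rvec w))%:E).

Lemma measurable_rvec_comp (F : N.-tuple R -> R) : measurable_fun setT F ->
  measurable_fun setT (fun w => (F (rvec w))%:E).
Proof.
move=> mF; apply/measurable_EFinP; apply: measurableT_comp => //.
exact: measurable_rvec.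
Qed.

Lemma meanE L F : (0 <= L)%R -> l1lip L F -> \int[P]_w (F (rvec w))%:E = (mean F)%:E.
Proof.
move=> L0 [mF F0 FL]; rewrite /mean fineK//.
rewrite ge0_fin_numE; last by apply: integral_ge0 => w _; rewrite lee_fin.
pose z : N.-tuple R := [tuple 0%R | i < N].
apply: (@le_lt_trans _ _ (\int[P]_w ((F z)%:E + \sum_(i < N) L%:E * `|(om i w)%:E|))).
  have ms i : measurable_fun setT (fun w => L%:E * `|(om i w)%:E|).
    apply: measurable_funeM; apply: measurableT_comp => //.
    by apply/measurable_EFinP; exact: measurable_funP.
  apply: ge0_le_integral => //.
  - by move=> w _; rewrite lee_fin.
  - exact: measurable_rvec_comp.
  - by apply: emeasurable_funD => //; exact: emeasurable_sum.
  - move=> w _; rewrite sumEFin -EFinD lee_fin; apply: le_trans (FL _ z) _.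
    by rewrite lerD2l; apply: ler_sum => i _; rewrite !tnth_mktuple subr0.
have is_ i : P.-integrable setT (fun w => L%:E * `|(om i w)%:E|).
  apply: integrableZl => //; apply: integrable_abse.
  exact: centered_integrable (om_gauss i).
have i1 : P.-integrable setT (fun w => (F z)%:E + \sum_(i < N) L%:E * `|(om i w)%:E|).
  apply: integrableD => //; first exact: finite_measure_integrable_cst.
  exact: integrable_sum.
by apply: integrable_lty => //; exact: i1.
Qed.

Lemma mean_ge0 F : (forall x, 0 <= F x)%R -> (0 <= mean F)%R.
Proof. by move=> F0; apply: fine_ge0; apply: integral_ge0 => w _; rewrite lee_fin. Qed.

Lemma mean_leD L F G (c : R) : (0 <= L)%R -> (0 <= c)%R -> l1lip L F -> l1lip L G ->
  (forall x, F x <= G x + c)%R -> (mean F <= mean G + c)%R.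
Proof.
move=> L0 c0 lF lG FG; rewrite -lee_fin -(meanE L0 lF) EFinD -(meanE L0 lG).
have [mF F0 _] := lF; have [mG G0 _] := lG.
have -> : c%:E = \int[P]_w c%:E.
  by rewrite integral_cst// -[LHS]mule1; congr (_ * _); exact/esym/probability_setT.
rewrite -ge0_integralD//; last first.
- exact: measurable_rvec_comp.
- by move=> w _; rewrite lee_fin.
apply: ge0_le_integral => //.
- by move=> w _; rewrite lee_fin.
- exact: measurable_rvec_comp.
- by apply: emeasurable_funD => //; exact: measurable_rvec_comp.
- by move=> w _; rewrite -EFinD lee_fin.
Qed.

(* [x] on the first [k] coordinates, [y] on the others *)
Notation glue k x y := (freeze (fun i : 'I_N => (i < k)%N) (tnth x) y).

Section transport.
Variables (l L : R) (H : nat -> N.-tuple R -> R).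
Hypotheses (l01 : (0 < l < 1)%R) (L0 : (0 <= L)%R).
Hypothesis HL : forall k, l1lip L (H k).
Hypothesis Hstep : forall (k : 'I_N) x y, (forall i, i != k -> tnth x i = tnth y i) ->
  (H k.+1 x <= H k y + (tnth x k - tnth y k) ^+ 2 / (sigma ^+ 2 *+ 2))%R.

(** The conditional mean of [H k] given the first [k] coordinates.  It interpolates
    between the number [mean (H 0)] and the function [H N]. *)
Let J (k : nat) (x : N.-tuple R) : R := mean (H k \o (fun y => glue k x y)).

Let JE k x : \int[P]_w (H k (glue k x (rvec w)))%:E = (J k x)%:E.
Proof. by rewrite -(meanE L0 (l1lip_freeze _ _ L0 (HL k))). Qed.

Let measurable_J k : measurable_fun setT (J k).
Proof.
have [mH H0 _] := HL k.
have mp : measurable_fun setT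
    (fun p : N.-tuple R * T => (H k (glue k p.1 (rvec p.2)))%:E).
  apply/measurable_EFinP; apply: measurableT_comp => //.
  apply/measurable_fun_tnthP => i; case: (boolP (i < k)%N) => ik.
    rewrite (_ : _ \o _ = (fun x => tnth x i) \o fst); last first.
      by apply/funext => x /=; rewrite tnth_freeze ik.
    by apply: measurableT_comp => //; exact: measurable_tnth.
  rewrite (_ : _ \o _ = om i \o snd); last first.
    by apply/funext => x /=; rewrite tnth_freeze (negbTE ik) tnth_mktuple.
  by apply: measurableT_comp => //; exact: measurable_funP.
have := @measurable_fun_fubini_tonelli_F _ _ _ _ R P _ mp.
move=> /(_ (fun p => _)) mF.
have {}mF : measurable_fun setT (fun x => (J k x)%:E).
  apply: eq_measurable_fun (mF _) => [x _|p]; last by rewrite lee_fin.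
  by rewrite /fubini_F/= JE.
exact/measurable_EFinP.
Qed.

(** Conditionally on the other coordinates this is [centered_transport] for the
    [k]-th coordinate: means preserve the inequality [Hstep] between [H k.+1] and
    [H k]. *)
Let J_step (k : 'I_N) :
  \int[P]_w (expR (l * J k.+1 (rvec w)))%:E <= \int[P]_w (expR (l * J k (rvec w)))%:E.
Proof.
have mE j : measurable_fun setT (fun x => (expR (l * J j x))%:E).
  apply/measurable_EFinP; apply: measurableT_comp => //.
  by apply: measurable_funM => //; exact: measurable_J.
rewrite (ge0_integral_upd k (mE k.+1)) => [|x]; last by rewrite lee_fin expR_ge0.
apply: ge0_le_integral => //.
- by move=> w _; apply: integral_ge0 => w' _; rewrite lee_fin expR_ge0.
- apply: (@measurable_upd_integral k (fun x => (expR (l * J k.+1 x))%:E) (mE k.+1)).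
  by move=> x; rewrite lee_fin expR_ge0.
- apply: (measurableT_comp (mE k)); exact: measurable_rvec.
have ltS (i : 'I_N) : i != k -> (i < k.+1)%N = (i < k)%N.
  by rewrite -val_eqE ltnS leq_eqVlt => /negbTE /= ->.
move=> w _; set x := rvec w.
pose h u := J k.+1 (upd x k u).
pose f u := mean (H k \o (fun y => glue k x (upd y k u))).
have lf u : l1lip L (H k \o (fun y => glue k x (upd y k u))).
  exact: (l1lip_freeze _ _ L0 (l1lip_freeze _ _ L0 (HL k))).
have lh u : l1lip L (H k.+1 \o (fun y => glue k.+1 (upd x k u) y)).
  exact: l1lip_freeze.
apply: (centered_transport (L := L) (m := J k x) (f := f) (h := h) sigma0 (om_gauss k) l01).
- move=> u v; apply: (mean_leD L0) => // [|y]; first by rewrite mulr_ge0.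
  have := l1lip_upd k (glue k x y) L0 (HL k) u v.
  rewrite /=; congr (H k _ <= H k _ + _)%R; apply: eq_from_tnth => i;
    by rewrite !tnth_freeze/=; case: eqVneq => // ->; rewrite ltnn.
- move=> u v; apply: (mean_leD L0) => // [|y]; first by rewrite mulr_ge0.
  have := l1lip_upd k (glue k x y) L0 (HL k.+1) u v.
  rewrite /=; congr (H k.+1 _ <= H k.+1 _ + _)%R; apply: eq_from_tnth => i;
    by rewrite !tnth_freeze/=; case: eqVneq => [->|/ltS ->]; rewrite ?ltnSn.
- by move=> u; apply: mean_ge0 => y; have [_ H0 _] := HL k; exact: H0.
- move=> u v; apply: (mean_leD L0) => // [|y].
    by rewrite divr_ge0 ?sqr_ge0// mulrn_wge0// sqr_ge0.
  have := @Hstep k (glue k.+1 (upd x k u) y) (glue k x (upd y k v)).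
  rewrite !tnth_freeze/= ltnSn ltnn eqxx; apply => i ik.
  by rewrite !tnth_freeze/= (negbTE ik) (ltS _ ik).
- have mg : measurable_fun setT (fun y => (H k (glue k x y))%:E).
    by apply/measurable_EFinP;
      have [] := l1lip_freeze (fun i : 'I_N => (i < k)%N) (tnth x) L0 (HL k).
  have [_ H0 _] := HL k.
  rewrite -JE (ge0_integral_updC k mg) => [|y]; last by rewrite lee_fin.
  by apply: eq_integral => w' _; rewrite /f -(meanE L0 (lf _)).
Qed.

(** The transport inequality tensorises: each coordinate is paid for by one step of
    quadratic cost. *)
Lemma transport_chain :
  \int[P]_w (expR (l * H N (rvec w)))%:E <= (expR (l * mean (H 0%N)))%:E.
Proof.
have JN x : J N x = H N x.
  rewrite /J /mean/=.
  have E y : glue N x y = x.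
    by apply: eq_from_tnth => i; rewrite tnth_freeze ltn_ord.
  under eq_integral do rewrite E.
  rewrite integral_cst// -[RHS]/(fine (H N x)%:E) -[in RHS](mule1 (H N x)%:E).
  by congr (fine (_ * _)); exact: probability_setT.
have J0 x : J 0%N x = mean (H 0%N).
  rewrite /J; congr mean; apply/funext => y /=; congr (H 0%N _).
  by apply: eq_from_tnth => i; rewrite tnth_freeze.
have key k : (k <= N)%N ->
    \int[P]_w (expR (l * J k (rvec w)))%:E <= \int[P]_w (expR (l * J 0%N (rvec w)))%:E.
  elim: k => [//|k IH kN]; apply: le_trans (IH (ltnW kN)).
  exact: (J_step (Ordinal kN)).
have := key N (leqnn N).
under eq_integral do rewrite JN.
under [X in _ <= X -> _]eq_integral do rewrite J0.
move=> h; apply: (le_trans h); rewrite integral_cst//.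
by rewrite -[leRHS]mule1; apply: lee_wpmul2l; rewrite ?lee_fin ?expR_ge0// probability_le1.
Qed.

End transport.

End chain.

(** * Contraction and maximal inequalities for Gaussian linear forms *)
Section bigmax0.
Context {R : realType} {K : finType}.
Implicit Types F G : K -> R.

Definition max0 F : R := \big[Num.max/0]_k F k.

Lemma max0_ge0 F : 0 <= max0 F.
Proof. exact: bigmax_ge_id. Qed.

Lemma le_max0 F k : F k <= max0 F.
Proof. exact: le_bigmax. Qed.

Lemma max0_le F x : 0 <= x -> (forall k, F k <= x) -> max0 F <= x.
Proof. by move=> x0 Fx; apply: bigmax_le. Qed.

(** A sum of two maxima is a maximum over pairs; the single bounds cover the cases
    where one of them is the default value 0. *)
Lemma max0D_le F G x : 0 <= x -> (forall k, F k <= x) -> (forall k, G k <= x) ->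
  (forall j k, F j + G k <= x) -> max0 F + max0 G <= x.
Proof.
move=> x0 Fx Gx FGx; rewrite -lerBrDr; apply: max0_le.
  by rewrite subr_ge0; exact: max0_le.
move=> j; rewrite lerBrDr addrC -lerBrDr; apply: max0_le.
  by rewrite subr_ge0.
by move=> k; rewrite lerBrDr addrC.
Qed.

Lemma max0_lip F G x : 0 <= x -> (forall k, F k <= G k + x) -> max0 F <= max0 G + x.
Proof.
move=> x0 FG; apply: max0_le; first by rewrite addr_ge0 ?max0_ge0.
by move=> k; apply: le_trans (FG k) _; rewrite lerD2r le_max0.
Qed.

End bigmax0.

Lemma measurable_max0 {d : measure_display} {T : measurableType d} {R : realType}
    (K : finType) (F : K -> T -> R) :
  (forall k, measurable_fun setT (F k)) ->
  measurable_fun setT (fun x => max0 (F ^~ x)).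
Proof.
move=> mF; rewrite /max0; elim: (index_enum K) => [|k s IH].
  by under eq_fun do rewrite big_nil; exact: measurable_cst.
by under eq_fun do rewrite big_cons; exact: measurable_maxr.
Qed.

Section lin.
Context {R : realType} {N : nat}.

Definition lin (c : 'I_N -> R) (x : N.-tuple R) : R := \sum_(i < N) c i * tnth x i.

Lemma measurable_lin c : measurable_fun setT (lin c).
Proof.
apply: measurable_sum => i; apply: measurable_funM => //; exact: measurable_tnth.
Qed.

Lemma l1lip_max (K : finType) (a : K -> R) (c : K -> 'I_N -> R) (L : R) :
  0 <= L -> (forall k i, `|c k i| <= L) ->
  l1lip L (fun x => max0 (fun k => lin (c k) x - a k)).
Proof.
move=> L0 cL; split => [|x|x y].
- apply: (measurable_max0 (F := fun k x => lin (c k) x - a k)) => k.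
  by apply: measurable_funB => //; exact: measurable_lin.
- exact: max0_ge0.
- apply: max0_lip; first by apply: sumr_ge0 => i _; rewrite mulr_ge0.
  move=> k; rewrite addrAC lerD2r /lin -lerBlDl -sumrB; apply: ler_sum => i _.
  rewrite -mulrBr; apply: (le_trans (ler_norm _)); rewrite normrM.
  exact: ler_wpM2r.
Qed.

Lemma measurable_max_lin (K : finType) (c : K -> 'I_N -> R) :
  measurable_fun setT (fun x => (max0 (fun k => lin (c k) x))%:E).
Proof.
apply/measurable_EFinP; apply: (measurable_max0 (F := fun k => lin (c k))) => k.
exact: measurable_lin.
Qed.

End lin.

Section deviation.
Context {d : measure_display} {T : measurableType d} {R : realType}.
Variable P : probability T R.
Variables (N : nat) (om : 'I_N -> {RV P >-> R}) (sigma : R).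
Hypothesis om_indep : mutually_independent om.
Hypothesis sigma0 : 0 < sigma.
Hypothesis om_gauss : forall i, centered_gaussian sigma (om i).
Notation rvec := (rvec om).
Notation upd x k u := (freeze (pred1 k) (fun=> u) x).
Notation mean := (mean om).

Lemma lin_upd c (x : N.-tuple R) (k : 'I_N) u :
  lin c (upd x k u) = \sum_(i < N | i != k) c i * tnth x i + c k * u.
Proof.
rewrite /lin (bigD1 k)//= tnth_freeze/= eqxx addrC; congr (_ + _).
by apply: eq_bigr => i ik; rewrite tnth_freeze/= (negbTE ik).
Qed.

(** With the other coordinates fixed, each form is [A_j + c_j u].  By symmetry of the
    law the mean over [u] is half the mean of the sum of the values at [u] and [- u],
    and that sum is a maximum over pairs [j, j'] of terms
    [A_j + A_j' + (c_j - c_j') u], each dominated by the corresponding term for [y]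
    or the one with [j] and [j'] exchanged. *)
Lemma contraction_step (K : finType) (k : 'I_N) (c y : K -> 'I_N -> R) :
  (forall j i, i != k -> c j i = y j i) ->
  (forall j, `|c j k| <= `|y j k|) ->
  (forall j j', `|c j k - c j' k| <= `|y j k - y j' k|) ->
  (\int[P]_w (max0 (fun j => lin (c j) (rvec w)))%:E <=
   \int[P]_w (max0 (fun j => lin (y j) (rvec w)))%:E)%E.
Proof.
move=> cyE cy cyd.
have mM (e : K -> 'I_N -> R) := measurable_max_lin e.
have M0 (e : K -> 'I_N -> R) x : (0%R <= (max0 (fun j => lin (e j) x))%:E)%E.
  by rewrite lee_fin max0_ge0.
rewrite (ge0_integral_upd om_indep k (mM c) (M0 c)) (ge0_integral_upd om_indep k (mM y) (M0 y)).
apply: ge0_le_integral => //.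
- by move=> w _; apply: integral_ge0.
- exact: (@measurable_upd_integral _ _ _ P N om k _ (mM c) (M0 c)).
- exact: (@measurable_upd_integral _ _ _ P N om k _ (mM y) (M0 y)).
move=> w _; set x := rvec w.
pose g (e : K -> 'I_N -> R) u := (max0 (fun j => lin (e j) (upd x k u)))%:E.
have mupd : measurable_fun setT (fun u : R => upd x k u).
  apply/measurable_fun_tnthP => i; case: (eqVneq i k) => ik.
    rewrite (_ : _ \o _ = id); first exact: measurable_id.
    by apply/funext => u /=; rewrite tnth_freeze/= ik eqxx.
  rewrite (_ : _ \o _ = cst (tnth x i)); first exact: measurable_cst.
  by apply/funext => u /=; rewrite tnth_freeze/= (negbTE ik).
have mg e : measurable_fun setT (g e) by exact: (measurableT_comp (mM e) mupd).
have mom : measurable_fun setT (om k) by exact: measurable_funP.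
have mg1 e : measurable_fun setT (fun w' => g e (om k w')).
  exact: (measurableT_comp (mg e) mom).
have mg2 e : measurable_fun setT (fun w' => g e (- om k w')).
  by apply: (measurableT_comp (mg e)); exact: measurableT_comp.
have g0 e u : (0%R <= g e u)%E by exact: M0.
have gD e : (\int[P]_w' (g e (om k w') + g e (- om k w')%R) =
    2%:E * \int[P]_w' g e (om k w'))%E.
  rewrite ge0_integralD//.
  rewrite -(centered_sym (om_gauss k) (mg e) (g0 e)).
  by rewrite -[2%R]/(1 + 1)%R EFinD ge0_muleDl ?lee_fin// !mul1e.
rewrite -[leLHS]/(\int[P]_w' g c (om k w'))%E -[leRHS]/(\int[P]_w' g y (om k w'))%E.
rewrite -(@lee_pmul2l _ 2%:E)// ?lte_fin// -!gD.
apply: ge0_le_integral => //.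
- by move=> w' _; rewrite adde_ge0.
- exact: emeasurable_funD.
- exact: emeasurable_funD.
move=> w' _; rewrite /g -!EFinD lee_fin; set u := om k w'.
have aE j : \sum_(i < N | i != k) c j i * tnth x i = \sum_(i < N | i != k) y j i * tnth x i.
  by apply: eq_bigr => i /cyE ->.
pose A j := \sum_(i < N | i != k) y j i * tnth x i.
pose F1 (e : K -> 'I_N -> R) j := A j + e j k * u.
pose F2 (e : K -> 'I_N -> R) j := A j - e j k * u.
have F1E e : (forall j i, i != k -> e j i = y j i) ->
    (fun j => lin (e j) (upd x k u)) = F1 e.
  move=> eE; apply/funext => j; rewrite lin_upd /F1; congr (_ + _).
  by apply: eq_bigr => i /eE ->.
have F2E e : (forall j i, i != k -> e j i = y j i) ->
    (fun j => lin (e j) (upd x k (- u))) = F2 e.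
  move=> eE; apply/funext => j; rewrite lin_upd /F2 mulrN; congr (_ - _).
  by apply: eq_bigr => i /eE ->.
rewrite !F1E// !F2E//.
have h1 j : F1 y j <= max0 (F1 y) by exact: le_max0.
have h2 j : F2 y j <= max0 (F2 y) by exact: le_max0.
have p1 : 0 <= max0 (F1 y) by exact: max0_ge0.
have p2 : 0 <= max0 (F2 y) by exact: max0_ge0.
have absM (a b : R) : a <= `|b| -> a <= b \/ a <= - b.
  by case: (ger0P b) => _ ab; [left|right].
have cu (e e' : R) : `|e| <= `|e'| -> e * u <= `|e' * u|.
  by move=> h; rewrite (le_trans (ler_norm _))// !normrM ler_wpM2r.
have cuN (e e' : R) : `|e| <= `|e'| -> - (e * u) <= `|e' * u|.
  by move=> h; rewrite -mulNr; apply: cu; rewrite normrN.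
apply: max0D_le.
- by rewrite addr_ge0.
- move=> j; have := absM _ _ (cu _ _ (cy j)); rewrite /F1.
  have := h1 j; have := h2 j; rewrite /F1 /F2.
  by move=> ? ? [] ?; lra.
- move=> j; have := absM _ _ (cuN _ _ (cy j)); rewrite /F2.
  have := h1 j; have := h2 j; rewrite /F1 /F2.
  by move=> ? ? [] ?; lra.
- move=> j j'; have := absM _ _ (cu _ _ (cyd j j')); rewrite /F1 /F2.
  have := h1 j; have := h2 j; have := h1 j'; have := h2 j'; rewrite /F1 /F2.
  by move=> ? ? ? ? [] ?; lra.
Qed.

(** The Ledoux-Talagrand contraction principle, in the form where the contracted
    coefficients are given by their increments. *)
Lemma contraction (K : finType) (c y : K -> 'I_N -> R) :
  (forall j i, `|c j i| <= `|y j i|) ->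
  (forall j j' i, `|c j i - c j' i| <= `|y j i - y j' i|) ->
  (\int[P]_w (max0 (fun j => lin (c j) (rvec w)))%:E <=
   \int[P]_w (max0 (fun j => lin (y j) (rvec w)))%:E)%E.
Proof.
move=> cy cyd.
pose hyb (n : nat) j (i : 'I_N) := if (i < n)%N then y j i else c j i.
pose I n := (\int[P]_w (max0 (fun j => lin (hyb n j) (rvec w)))%:E)%E.
have hybS n : (n <= N)%N -> (I 0%N <= I n)%E.
  elim: n => [//|n IH nN]; apply: (le_trans (IH (ltnW nN))).
  apply: (contraction_step (k := Ordinal nN)) => [j i|j|j j']; rewrite /hyb/=.
  - by rewrite -val_eqE/= ltnS [(i <= n)%N]leq_eqVlt => /negbTE ->.
  - by rewrite ltnn ltnSn.
  - by rewrite ltnn ltnSn.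
have := hybS N (leqnn N); rewrite /I.
have -> : hyb 0%N = c by apply/funext => j; apply/funext => i.
by have -> : hyb N = y by apply/funext => j; apply/funext => i; rewrite /hyb ltn_ord.
Qed.

(** The coordinates are replaced one by one by the bound on their exponential
    moment. *)
Lemma mgf_lin (e : 'I_N -> R) :
  (\int[P]_w (expR (lin e (rvec w)))%:E <=
   (expR (sigma ^+ 2 * (\sum_(i < N) e i ^+ 2) / 2))%:E)%E.
Proof.
pose G (n : nat) (x : N.-tuple R) := expR (\sum_(i < N)
  if (i < n)%N then e i ^+ 2 * sigma ^+ 2 / 2 else e i * tnth x i).
have mG n : measurable_fun setT (fun x => (G n x)%:E).
  apply/measurable_EFinP; apply: measurableT_comp => //.
  apply: measurable_sum => i; case: (i < n)%N => //.
  by apply: measurable_funM => //; exact: measurable_tnth.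
have G0 n x : (0%R <= (G n x)%:E)%E by rewrite lee_fin expR_ge0.
have step n : (n <= N)%N ->
    (\int[P]_w (G 0%N (rvec w))%:E <= \int[P]_w (G n (rvec w))%:E)%E.
  elim: n => [//|n IH nN]; apply: (le_trans (IH (ltnW nN))).
  pose k := Ordinal nN.
  rewrite (ge0_integral_upd om_indep k (mG n) (G0 n)).
  apply: ge0_le_integral => //.
  - by move=> w _; apply: integral_ge0.
  - exact: (@measurable_upd_integral _ _ _ P N om k _ (mG n) (G0 n)).
  - exact: (measurableT_comp (mG n.+1) (measurable_rvec om)).
  move=> w _; set x := rvec w.
  pose r := \sum_(i < N | i != k)
    if (i < n)%N then e i ^+ 2 * sigma ^+ 2 / 2 else e i * tnth x i.
  have GnE u : G n (upd x k u) = expR r * expR (e k * u).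
    rewrite /G (bigD1 k)//= ltnn tnth_freeze/= eqxx addrC expRD; congr (expR _ * _).
    by apply: eq_bigr => i ik; rewrite tnth_freeze/= (negbTE ik).
  have GSE : G n.+1 x = expR r * expR (e k ^+ 2 * sigma ^+ 2 / 2).
    rewrite /G (bigD1 k)//= ltnSn addrC expRD; congr (expR _ * _).
    by apply: eq_bigr => i; rewrite -val_eqE/= ltnS [(i <= n)%N]leq_eqVlt => /negbTE ->.
  under eq_integral do rewrite GnE EFinM.
  rewrite ge0_integralZl; [|by []| |by move=> w' _; rewrite lee_fin expR_ge0
    |by rewrite lee_fin expR_ge0]; last first.
    apply/measurable_EFinP; apply: measurableT_comp => //.
    by apply: measurable_funM => //; exact: measurable_funP.
  rewrite GSE EFinM; apply: lee_wpmul2l; first by rewrite lee_fin expR_ge0.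
  exact: centered_mgf sigma0 (om_gauss k) (e k).
have := step N (leqnn N).
have -> : (fun w => (G 0%N (rvec w))%:E) = (fun w => (expR (lin e (rvec w)))%:E) by [].
move=> h; apply: (le_trans h).
have -> : (fun w => (G N (rvec w))%:E) =
    cst (expR (sigma ^+ 2 * (\sum_(i < N) e i ^+ 2) / 2))%:E.
  apply/funext => w; rewrite /G; congr (expR _)%:E.
  rewrite mulr_sumr mulr_suml; apply: eq_bigr => i _.
  by rewrite ltn_ord [_ * sigma ^+ 2]mulrC.
rewrite integral_cst// -[leRHS]mule1; apply: lee_wpmul2l; first by rewrite lee_fin expR_ge0.
exact: probability_le1.
Qed.

(** For a number [mu], [exp(mu max)] is at most the sum of the [2 p] exponentials of
    the signed forms, each of mean at most [exp(mu^2 sigma^2 V / 2)]; Jensen's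
    inequality then bounds the mean of the maximum, and the value of [mu] below
    balances the two terms. *)
Lemma maximal_abs (p : nat) (e : 'I_p -> 'I_N -> R) (V : R) : (0 < p)%N -> 0 < V ->
  (forall j, \sum_(i < N) e j i ^+ 2 <= V) ->
  (\int[P]_w (max0 (fun j => `|lin (e j) (rvec w)|))%:E <=
   (sigma * Num.sqrt V * Num.sqrt (2 * ln (2 * p)%:R))%:E)%E.
Proof.
move=> p0 V0 eV.
have n1 : 1 < (2 * p)%:R :> R by rewrite ltr1n; case: (p) p0 => [|n] _ //; rewrite mul2n doubleS.
have lnp : 0 < ln ((2 * p)%:R : R) by exact: ln_gt0.
set B := sigma * _ * _.
set q := ln ((2 * p)%:R : R) in lnp B *.
have sV : 0 < Num.sqrt V by rewrite sqrtr_gt0.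
pose mu := Num.sqrt (2 * q) / (sigma * Num.sqrt V).
have sq : 0 < Num.sqrt (2 * q) by rewrite sqrtr_gt0 mulr_gt0.
have mu0 : 0 < mu by rewrite divr_gt0// mulr_gt0.
have muV : mu ^+ 2 * sigma ^+ 2 * V = 2 * q.
  rewrite /mu expr_div_n exprMn !sqr_sqrtr ?mulr_ge0 ?ltW//.
  by field; rewrite !gt_eqF.
have muB : mu * B = 2 * q.
  rewrite /mu /B -[RHS](@sqr_sqrtr _ (2 * q)) ?mulr_ge0 ?ltW//.
  by field; rewrite !gt_eqF.
pose S (x : N.-tuple R) := \sum_(j < p)
  (expR (lin (fun i => mu * e j i) x) + expR (lin (fun i => - mu * e j i) x)).
have linZ t j x : lin (fun i => t * e j i) x = t * lin (e j) x.
  by rewrite /lin mulr_sumr; apply: eq_bigr => i _; rewrite mulrA.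
have S1 x : 0 <= S x by apply: sumr_ge0 => j _; rewrite addr_ge0 ?expR_ge0.
have SE j x : expR (mu * `|lin (e j) x|) <= S x.
  rewrite /S (bigD1 j)//= !linZ; set t := lin (e j) x.
  apply: le_trans (_ : expR (mu * t) + expR (- mu * t) <= _); last first.
    by rewrite lerDl; apply: sumr_ge0 => i _; rewrite addr_ge0 ?expR_ge0.
  case: (lerP 0 t) => t0; first by rewrite ger0_norm// lerDl expR_ge0.
  by rewrite ltr0_norm// mulrN -mulNr lerDr expR_ge0.
(* Jensen's inequality in the form of the tangent line of [expR] at [a] *)
pose a := q + q.
have key x : mu * max0 (fun j => `|lin (e j) x|) + 1 <= a + expR (- a) * S x.
  have tan t : 1 + t <= a + expR (- a) * expR t.
    rewrite -expRD; have := expR_ge1Dx (- a + t); lra.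
  have j0 : 'I_p by exact: (Ordinal p0).
  rewrite -lerBrDr mulrC -ler_pdivlMr//; apply: max0_le => [|j].
    rewrite divr_ge0 ?(ltW mu0)// subr_ge0.
    apply: (le_trans (_ : 1 <= 1 + mu * `|lin (e j0) x|)).
      by rewrite lerDl mulr_ge0// ltW.
    by apply: (le_trans (tan _)); rewrite lerD2l ler_wpM2l ?expR_ge0.
  rewrite ler_pdivlMr// mulrC lerBrDr addrC.
  by apply: (le_trans (tan _)); rewrite lerD2l ler_wpM2l ?expR_ge0.
have mlinE (t : 'I_N -> R) : measurable_fun setT (fun w => (expR (lin t (rvec w)))%:E).
  apply/measurable_EFinP; apply: measurableT_comp => //.
  exact: (measurableT_comp (measurable_lin t) (measurable_rvec om)).
have IS : (\int[P]_w (S (rvec w))%:E <= (expR a)%:E)%E.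
  under eq_integral do rewrite /S -sumEFin.
  rewrite ge0_integral_sum//; last first.
    by move=> j; under eq_fun do rewrite EFinD; exact: emeasurable_funD.
  apply: (@le_trans _ _ (\sum_(j < p) (2 * expR q)%:E)%E).
    apply: lee_sum => j _; under eq_integral do rewrite EFinD.
    rewrite ge0_integralD; [|by []|by move=> w _; rewrite lee_fin expR_ge0|exact: mlinE
      |by move=> w _; rewrite lee_fin expR_ge0|exact: mlinE].
    have E t : t ^+ 2 = mu ^+ 2 ->
        (\int[P]_w (expR (lin (fun i => t * e j i) (rvec w)))%:E <= (expR q)%:E)%E.
      move=> tmu; apply: (le_trans (mgf_lin _)); rewrite lee_fin ler_expR.
      have -> : \sum_(i < N) (t * e j i) ^+ 2 = mu ^+ 2 * \sum_(i < N) e j i ^+ 2.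
        by rewrite mulr_sumr; apply: eq_bigr => i _; rewrite exprMn tmu.
      rewrite ler_pdivrMr// mulrA [q * 2]mulrC -muV [sigma ^+ 2 * _]mulrC.
      by apply: ler_wpM2l => //; rewrite mulr_ge0 ?sqr_ge0.
    rewrite mulr_natl mulr2n EFinD; apply: leeD; apply: E => //.
    by rewrite sqrrN.
  rewrite sumEFin lee_fin sumr_const card_ord -mulr_natr.
  rewrite /a expRD {2}/q lnK ?posrE ?(lt_trans _ n1)//.
  by rewrite natrM le_eqVlt; apply/orP; left; apply/eqP; ring.
have mS : measurable_fun setT S.
  apply: measurable_sum => j; apply: measurable_funD; apply: measurableT_comp => //;
    exact: measurable_lin.
have mM : measurable_fun setT (fun x : N.-tuple R => max0 (fun j => `|lin (e j) x|)).
  apply: (measurable_max0 (F := fun j x => `|lin (e j) x|)) => j.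
  by apply: measurableT_comp => //; exact: measurable_lin.
have mr := measurable_rvec om.
have mMr : measurable_fun setT (fun w => (max0 (fun j => `|lin (e j) (rvec w)|))%:E).
  by apply/measurable_EFinP; exact: (measurableT_comp mM mr).
have mSr : measurable_fun setT (fun w => (S (rvec w))%:E).
  by apply/measurable_EFinP; exact: (measurableT_comp mS mr).
have Pc (c : R) : (\int[P]_w c%:E = c%:E)%E.
  by rewrite integral_cst// -[RHS]mule1; congr (_ * _)%E; exact: probability_setT.
have a0 : 0 <= a by rewrite addr_ge0 ?ltW.
have : (mu%:E * \int[P]_w (max0 (fun j => `|lin (e j) (rvec w)|))%:E + 1%:E <=
   a%:E + (expR (- a))%:E * \int[P]_w (S (rvec w))%:E)%E.
  rewrite -(Pc 1) -(Pc a).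
  rewrite -ge0_integralZl; [|by []|exact: mMr|by move=> w _; rewrite lee_fin max0_ge0
    |by rewrite lee_fin ltW].
  rewrite -ge0_integralZl; [|by []|exact: mSr|by move=> w _; rewrite lee_fin
    |by rewrite lee_fin expR_ge0].
  rewrite -ge0_integralD; [|by []|by move=> w _; rewrite mule_ge0// lee_fin ?max0_ge0// ltW
    |exact: measurable_funeM|by move=> w _; rewrite lee_fin|exact: measurable_cst].
  rewrite -ge0_integralD; [|by []|by move=> w _; rewrite lee_fin|exact: measurable_cst
    |by move=> w _; rewrite mule_ge0// lee_fin ?expR_ge0|exact: measurable_funeM].
  apply: ge0_le_integral => //.
  - by move=> w _; rewrite adde_ge0// mule_ge0// lee_fin ?max0_ge0// ltW.
  - by apply: emeasurable_funD => //; exact: measurable_funeM.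
  - by apply: emeasurable_funD => //; exact: measurable_funeM.
  - by move=> w _; rewrite -!EFinM -!EFinD lee_fin.
move=> h; have {h} : (mu%:E * \int[P]_w (max0 (fun j => `|lin (e j) (rvec w)|))%:E + 1%:E
    <= a%:E + 1%:E)%E.
  apply: (le_trans h); rewrite leeD2l//.
  apply: (le_trans (lee_wpmul2l _ IS)); first by rewrite lee_fin expR_ge0.
  by rewrite -EFinM -expRD addNr expR0.
rewrite leeD2rE// muleC -lee_pdivlMr//.
rewrite -EFinM => /le_trans; apply; rewrite lee_fin.
by rewrite ler_pdivrMr// [B * _]mulrC muB /a; lra.
Qed.

End deviation.

(** * Deviation of the maximum of a finite family of linear forms *)
Lemma lt_max0 {R : realType} {K : finType} (F : K -> R) (x : R) : 0 <= x ->
  x < max0 F -> exists k, x < F k.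
Proof.
move=> x0 xF; apply: contrapT => /forallNP h.
move: xF; rewrite ltNge => /negP; apply; apply: max0_le => // k.
by rewrite leNgt; exact/negP.
Qed.

Section finite_deviation.
Context {d : measure_display} {T : measurableType d} {R : realType}.
Variable P : probability T R.
Variables (N : nat) (om : 'I_N -> {RV P >-> R}) (sigma : R).
Hypothesis om_indep : mutually_independent om.
Hypothesis sigma0 : 0 < sigma.
Hypothesis om_gauss : forall i, centered_gaussian sigma (om i).
Notation rvec := (rvec om).
Notation mean := (mean om).

(** The penalty [sigma^2 |c_k|^2 / 2] is the amount by which
    [min_y (c_k y + (x - y)^2 / (2 sigma^2))] falls below [c_k x].  Charging it one
    coordinate at a time makes the successive maxima satisfy the hypothesis of
    [transport_chain]. *)
Lemma gaussian_max_mgf (K : finType) (c : K -> 'I_N -> R) (l : R) : 0 < l < 1 ->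
  (\int[P]_w (expR (l * max0 (fun k => (lin (c k) (rvec w)
      - sigma ^+ 2 * (\sum_(i < N) c k i ^+ 2) / 2)%R)))%:E <=
   (expR (l * mean (fun x => max0 (fun k => lin (c k) x))))%:E)%E.
Proof.
move=> l01.
pose L := \sum_k \sum_i `|c k i|.
have cL k i : `|c k i| <= L.
  rewrite /L (bigD1 k)//= (bigD1 i)//= -addrA lerDl addr_ge0// sumr_ge0// => ? _.
  exact: sumr_ge0.
have L0 : 0 <= L by apply: sumr_ge0 => k _; exact: sumr_ge0.
pose H n (x : N.-tuple R) := max0 (fun k =>
  lin (c k) x - \sum_(i < N | (i < n)%N) sigma ^+ 2 * c k i ^+ 2 / 2).
have HL n : l1lip L (H n) by exact: l1lip_max.
have Hstep (n : 'I_N) x y : (forall i, i != n -> tnth x i = tnth y i) ->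
    H n.+1 x <= H n y + (tnth x n - tnth y n) ^+ 2 / (sigma ^+ 2 *+ 2).
  move=> xy; have s2 : 0 < sigma ^+ 2 by rewrite exprn_gt0.
  apply: max0_lip => [|k]; first by rewrite divr_ge0 ?sqr_ge0// mulrn_wge0// ltW.
  have -> : \sum_(i < N | (i < n.+1)%N) sigma ^+ 2 * c k i ^+ 2 / 2 =
      sigma ^+ 2 * c k n ^+ 2 / 2 + \sum_(i < N | (i < n)%N) sigma ^+ 2 * c k i ^+ 2 / 2.
    rewrite (bigD1 n)//=; congr (_ + _); apply: eq_bigl => i.
    by rewrite -val_eqE/= ltnS; case: ltngtP.
  have -> : lin (c k) x = lin (c k) y + c k n * (tnth x n - tnth y n).
    rewrite /lin (bigD1 n)//= [in RHS](bigD1 n)//=.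
    rewrite (eq_bigr (fun i => c k i * tnth y i)) => [|i /xy -> //]; ring.
  set D := tnth x n - tnth y n; set S := \sum_(_ < _ | _) _.
  have -> : D ^+ 2 / (sigma ^+ 2 *+ 2) =
      (D - sigma ^+ 2 * c k n) ^+ 2 / (2 * sigma ^+ 2) + c k n * D - sigma ^+ 2 * c k n ^+ 2 / 2.
    by field; rewrite gt_eqF.
  have : 0 <= (D - sigma ^+ 2 * c k n) ^+ 2 / (2 * sigma ^+ 2).
    by rewrite divr_ge0 ?sqr_ge0// mulr_ge0// ltW.
  lra.
have := transport_chain om_indep sigma0 om_gauss l01 L0 HL Hstep.
have -> : H 0%N = (fun x => max0 (fun k => lin (c k) x)).
  apply/funext => x; rewrite /H; congr max0; apply/funext => k.
  by rewrite big_pred0 ?subr0.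
apply: le_trans; rewrite le_eqVlt; apply/orP; left; apply/eqP.
apply: eq_integral => w _; congr (expR (l * _))%:E; rewrite /H; congr max0.
apply/funext => k; congr (_ - _); rewrite mulr_sumr mulr_suml.
by apply: eq_bigl => i; rewrite ltn_ord.
Qed.

Section bound.
Variables (K : finType) (p : nat).
Variables (e : 'I_p -> 'I_N -> R) (c : K -> 'I_N -> R) (u : K -> 'I_p -> R).
Variables (L Q V V1 : R).
Let y k i := \sum_(j < p) e j i * u k j.
Hypotheses (p0 : (0 < p)%N) (L0 : 0 <= L) (Q0 : 0 <= Q) (V0 : 0 < V) (V10 : 0 < V1).
Hypothesis eV1 : forall j, \sum_(i < N) e j i ^+ 2 <= V1.
Hypothesis cy : forall k i, `|c k i| <= L * `|y k i|.
Hypothesis cyd : forall k k' i, `|c k i - c k' i| <= L * `|y k i - y k' i|.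
Hypothesis uQ : forall k, \sum_(j < p) `|u k j| <= Q.
Hypothesis cV : forall k, \sum_(i < N) c k i ^+ 2 <= V.

Let B := sigma * Num.sqrt V1 * Num.sqrt (2 * ln (2 * p)%:R).

(** Contraction reduces to forms linear in [u k], for which
    [sum_j u_j W_j <= (sum_j |u_j|) max_j |W_j|]. *)
Lemma mean_max_contraction (t : R) :
  (\int[P]_w (max0 (fun k => lin (fun i => (t * c k i)%R) (rvec w)))%:E <=
   (`|t| * (L * Q * B))%:E)%E.
Proof.
apply: (le_trans (contraction om_indep om_gauss
    (y := fun k i => `|t| * L * y k i) _ _)).
- by move=> k i; rewrite !normrM normr_id -mulrA ler_wpM2l// (ger0_norm L0).
- move=> k k' i; rewrite -!mulrBr !normrM normr_id -mulrA ler_wpM2l//.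
  by rewrite (ger0_norm L0).
pose W (x : N.-tuple R) := max0 (fun j => `|lin (e j) x|).
have mW : measurable_fun setT W.
  apply: (measurable_max0 (F := fun j x => `|lin (e j) x|)) => j.
  by apply: measurableT_comp => //; exact: measurable_lin.
have mWr : measurable_fun setT (fun w => (W (rvec w))%:E).
  by apply/measurable_EFinP; exact: (measurableT_comp mW (measurable_rvec om)).
have tL : 0 <= `|t| * L * Q by rewrite !mulr_ge0.
apply: (@le_trans _ _ (\int[P]_w ((`|t| * L * Q)%:E * (W (rvec w))%:E))%E).
  apply: ge0_le_integral => //.
  - by move=> w _; rewrite lee_fin max0_ge0.
  - exact: (measurableT_comp (measurable_max_lin _) (measurable_rvec om)).
  - exact: measurable_funeM.
  move=> w _; rewrite -EFinM lee_fin; apply: max0_le => [|k].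
    by rewrite mulr_ge0// max0_ge0.
  set x := rvec w.
  have -> : lin (fun i => `|t| * L * y k i) x =
      `|t| * L * \sum_(j < p) u k j * lin (e j) x.
    rewrite /lin mulr_sumr.
    under [RHS]eq_bigr do rewrite !mulr_sumr.
    rewrite exchange_big/=; apply: eq_bigr => i _.
    rewrite /y mulr_sumr mulr_suml; apply: eq_bigr => j _; ring.
  rewrite -[leRHS]mulrA; apply: ler_wpM2l; first by rewrite mulr_ge0.
  apply: (@le_trans _ _ (\sum_(j < p) `|u k j| * W x)).
    apply: ler_sum => j _; apply: (le_trans (ler_norm _)); rewrite normrM.
    apply: ler_wpM2l => //; exact: (le_max0 (fun j => `|lin (e j) x|)).
  by rewrite -mulr_suml; apply: ler_wpM2r => //; exact: max0_ge0.
rewrite ge0_integralZl; [|by []|exact: mWr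
  |by move=> w _; rewrite lee_fin max0_ge0|by rewrite lee_fin].
apply: (le_trans (lee_wpmul2l _ (maximal_abs om_indep sigma0 om_gauss p0 V10 eV1))).
  by rewrite lee_fin.
by rewrite -EFinM lee_fin -/B !mulrA.
Qed.

(** Scaling all forms by [b] and penalising, [gaussian_max_mgf] gives
    [ln P(A) <= l (b E M - b (2 M' + r) + b^2 sigma^2 V / 2)], where [M] is the maximum
    of the absolute values and [M'] bounds the means of the maxima over either sign.
    The choice [b = r / (sigma^2 V)] leaves [- l r^2 / (2 sigma^2 V) = l ln q], and [l]
    may be taken arbitrarily close to 1. *)
Lemma finite_deviation (q : R) : 0 < q < 1 ->
  (P [set w | (2 * (L * Q * B) + sigma * Num.sqrt V * Num.sqrt (2 * ln q^-1) <
        max0 (fun k => `|lin (c k) (rvec w)|))%R] <= q%:E)%E.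
Proof.
move=> /andP[q0 q1].
have lq : 0 < ln q^-1 by rewrite ln_gt0// invf_gt1.
set M := L * Q * B; set r := sigma * _ * _; set A := [set w | _].
have B0 : 0 <= B by rewrite !mulr_ge0// ltW.
have M0 : 0 <= M by apply: mulr_ge0 => //; exact: mulr_ge0.
have r0 : 0 < r by rewrite !mulr_gt0// sqrtr_gt0// mulr_gt0.
have sV : 0 < Num.sqrt V by rewrite sqrtr_gt0.
have r2 : r ^+ 2 = sigma ^+ 2 * V * (2 * ln q^-1).
  by rewrite /r !exprMn !sqr_sqrtr ?mulr_ge0// ltW.
pose b := r / (sigma ^+ 2 * V).
have sV2 : 0 < sigma ^+ 2 * V by rewrite mulr_gt0// exprn_gt0.
have b0 : 0 < b by rewrite divr_gt0.
(* absolute values are maxima over both signs *)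
pose cs (k : bool * K) i := (if k.1 then b else - b) * c k.2 i.
pose pen (k : bool * K) := sigma ^+ 2 * (\sum_(i < N) cs k i ^+ 2) / 2.
have csE k : \sum_(i < N) cs k i ^+ 2 = b ^+ 2 * \sum_(i < N) c k.2 i ^+ 2.
  by rewrite mulr_sumr; apply: eq_bigr => i _; rewrite /cs exprMn; case: k.1; rewrite ?sqrrN.
pose H (x : N.-tuple R) := max0 (fun k => lin (cs k) x - pen k).
have mA : measurable A.
  have mf : measurable_fun setT (fun w => max0 (fun k => `|lin (c k) (rvec w)|)).
    apply: (measurable_max0 (F := fun k w => `|lin (c k) (rvec w)|)) => k.
    apply: measurableT_comp => //.
    exact: (measurableT_comp (measurable_lin (c k)) (measurable_rvec om)).
  have : measurable_fun setT (fun w => 2 * M + r < max0 (fun k => `|lin (c k) (rvec w)|)).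
    by apply: measurable_fun_ltr => //; exact: measurable_cst.
  by move=> /(_ measurableT [set true]); rewrite setTI; exact.
have mH : measurable_fun setT (fun w => H (rvec w)).
  have mH : measurable_fun setT H.
    apply: (measurable_max0 (F := fun k x => lin (cs k) x - pen k)) => k.
    by apply: measurable_funB => //; exact: measurable_lin.
  exact: (measurableT_comp mH (measurable_rvec om)).
have meanM : mean (fun x => max0 (fun k => lin (cs k) x)) <= b * (2 * M).
  have mmax (e' : K -> 'I_N -> R) :
      measurable_fun setT (fun w => (max0 (fun k => lin (e' k) (rvec w)))%:E).
    exact: (measurableT_comp (measurable_max_lin e') (measurable_rvec om)).
  have : (\int[P]_w (max0 (fun k => lin (cs k) (rvec w)))%:E <= (b * (2 * M))%:E)%E.
    apply: (@le_trans _ _ (\int[P]_w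
       ((max0 (fun k => lin (fun i => (b * c k i)%R) (rvec w)))%:E +
        (max0 (fun k => lin (fun i => (- b * c k i)%R) (rvec w)))%:E))%E).
      apply: ge0_le_integral => //.
      - by move=> w _; rewrite lee_fin max0_ge0.
      - exact: (measurableT_comp (measurable_max_lin cs) (measurable_rvec om)).
      - by apply: emeasurable_funD; exact: mmax.
      move=> w _; rewrite -EFinD lee_fin; apply: max0_le.
        by rewrite addr_ge0 ?max0_ge0.
      move=> [[] k]; rewrite /cs/=.
        rewrite -[leLHS]addr0; apply: lerD; last exact: max0_ge0.
        exact: (le_max0 (fun k => lin (fun i => b * c k i) (rvec w))).
      rewrite -[leLHS]add0r; apply: lerD; first exact: max0_ge0.
      exact: (le_max0 (fun k => lin (fun i => - b * c k i) (rvec w))).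
    rewrite ge0_integralD; [|by []|by move=> w _; rewrite lee_fin max0_ge0|exact: mmax
      |by move=> w _; rewrite lee_fin max0_ge0|exact: mmax].
    apply: (le_trans (leeD (mean_max_contraction b) (mean_max_contraction (- b)))).
    rewrite normrN (gtr0_norm b0) -EFinD lee_fin -/M; lra.
  rewrite /mean; case: (\int[P]_w _)%E => [z| |]//= _.
  by apply: mulr_ge0; [exact: ltW|exact: mulr_ge0].
have key l : 0 < l < 1 -> (P A <= (expR (l * ln q))%:E)%E.
  move=> l01; have /andP[l0 l1] := l01.
  pose h0 := b * (2 * M + r) - b ^+ 2 * sigma ^+ 2 * V / 2.
  have AH w : A w -> h0 <= H (rvec w).
    rewrite /A/= => /lt_max0 -/(_ _)[]; first by rewrite addr_ge0 ?mulr_ge0// ltW.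
    move=> k kA; set x := rvec w in kA *.
    have pk : pen (true, k) <= b ^+ 2 * sigma ^+ 2 * V / 2.
      rewrite /pen csE/=.
      have := ler_wpM2l (mulr_ge0 (sqr_ge0 sigma) (sqr_ge0 b)) (cV k); lra.
    have pk' : pen (false, k) = pen (true, k) by rewrite /pen !csE.
    have linb t : lin (fun i => t * c k i) x = t * lin (c k) x.
      by rewrite /lin mulr_sumr; apply: eq_bigr => i _; rewrite mulrA.
    have h1 : b * (2 * M + r) <= b * `|lin (c k) x| by rewrite ler_pM2l// ltW.
    case: (ger0P (lin (c k) x)) h1 => s h1.
      apply: le_trans (le_max0 (fun k => lin (cs k) x - pen k) (true, k)).
      by rewrite {1}/cs/= linb /h0; lra.
    apply: le_trans (le_max0 (fun k => lin (cs k) x - pen k) (false, k)).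
    by rewrite {1}/cs/= linb /h0 pk'; lra.
  have : (P A <= (expR (- (l * h0)))%:E * \int[P]_w (expR (l * H (rvec w)))%:E)%E.
    have mE : measurable_fun setT (fun w => (expR (l * H (rvec w)))%:E).
      apply/measurable_EFinP; apply: measurableT_comp => //.
      by apply: measurable_funM.
    rewrite -ge0_integralZl; [|by []|exact: mE|by move=> w _; rewrite lee_fin expR_ge0
      |by rewrite lee_fin expR_ge0].
    rewrite -[P A]/(P A) -(setIT A) -(integral_indic P measurableT mA).
    apply: ge0_le_integral => //.
    - exact/measurable_EFinP/measurable_indic.
    - exact: measurable_funeM.
    move=> w _; rewrite -EFinM -expRD lee_fin indicE.
    case: (boolP (w \in A)) => [/set_mem/AH h|_]; last exact: expR_ge0.
    rewrite -[leLHS]expR0 ler_expR addrC subr_ge0.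
    by apply: ler_wpM2l => //; exact: ltW.
  move=> /le_trans; apply.
  apply: (le_trans (lee_wpmul2l _ (gaussian_max_mgf cs l01))); first by rewrite lee_fin expR_ge0.
  rewrite -EFinM -expRD lee_fin ler_expR.
  have hb : b * r - b ^+ 2 * sigma ^+ 2 * V / 2 = - ln q.
    rewrite -lnV ?posrE//.
    have -> : b * r - b ^+ 2 * sigma ^+ 2 * V / 2 = r ^+ 2 / (2 * (sigma ^+ 2 * V)).
      by rewrite /b; field; rewrite !gt_eqF.
    by rewrite r2; field; rewrite !gt_eqF.
  have := ler_wpM2l (ltW l0) meanM; rewrite /h0.
  have -> : l * ln q = - (l * (b * r - b ^+ 2 * sigma ^+ 2 * V / 2)) by rewrite hb; ring.
  lra.
have PA1 : (P A <= 1)%E by exact: probability_le1.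
have PA0 : (0 <= P A)%E by exact: measure_ge0.
case: (P A) PA0 PA1 key => [s| |]//; rewrite !lee_fin => s0 s1 key.
rewrite leNgt; apply/negP => qs.
have s0' : 0 < s by exact: lt_trans qs.
have lqs : ln q < ln s by rewrite ltr_ln ?posrE.
have ls : ln s <= 0 by exact: ln_le0.
have lq0 : ln q < 0 by exact: lt_le_trans ls.
(* if [q < s = P A], this [l < 1] makes [l ln q] the midpoint of [ln q] and [ln s] *)
have := key ((ln s + ln q) / (2 * ln q)).
have -> : (ln s + ln q) / (2 * ln q) * ln q = (ln s + ln q) / 2.
  by field; rewrite lt_eqF.
rewrite lee_fin -ler_ln ?posrE ?expR_gt0// expRK => h.
have : ln s <= (ln s + ln q) / 2.
  apply: h; apply/andP; split.
    by rewrite -[X in _ < X]mulrNN -invrN divr_gt0//; lra.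
  by rewrite ltr_ndivrMr; lra.
by lra.
Qed.

End bound.
End finite_deviation.

(** * Taylor remainders and their quotients *)
Section taylor.
Context {R : realType}.
Implicit Types (f g : R -> R) (I : set R).

Definition taylor_rem (m : nat) f (s x : R) : R :=
  f x - \sum_(k < m.+1) k`!%:R^-1 * (f^`(k)%classic s * (x - s) ^+ k).

Lemma derive1nSr f n : (f^`(n.+1) = (f^`())^`(n))%classic.
Proof. by rewrite /derive1n iterSr. Qed.

Lemma is_derive_pow (s x : R) (n : nat) :
  is_derive x 1 (fun y => (y - s) ^+ n) (n%:R * (x - s) ^+ n.-1).
Proof.
have d1 : is_derive x 1 (id - cst s : R -> R) (1 - 0) by exact: is_deriveB.
have h := is_deriveX n d1.
rewrite (_ : (fun y => (y - s) ^+ n) = (id - cst s) ^+ n); last by rewrite exprfctE.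
by apply: (is_derive_eq h); rewrite subr0 [LHS]mulr1.
Qed.

(** The inductions on [m] rest on this: differentiating [f] lowers the order. *)
Lemma is_derive_taylor_rem m f (s x : R) : derivable f x 1 ->
  is_derive x 1 (taylor_rem m.+1 f s) (taylor_rem m (f^`())%classic s x).
Proof.
move=> dfx.
pose h (k : 'I_m.+2) y := k`!%:R^-1 * (f^`(k)%classic s * (y - s) ^+ k).
pose dh (k : 'I_m.+2) := k`!%:R^-1 * (f^`(k)%classic s * (k%:R * (x - s) ^+ k.-1)).
have dhE k : is_derive x 1 (h k) (dh k).
  have p := is_derive_pow s x k.
  have := is_deriveZ (k`!%:R^-1 * f^`(k)%classic s) p => q.
  rewrite (_ : h k = (k`!%:R^-1 * f^`(k)%classic s) \*: (fun y => (y - s) ^+ k)); last first.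
    by apply/funext => y; rewrite /h mulrA.
  by apply: (is_derive_eq q); rewrite /dh [RHS]mulrA.
have df : is_derive x 1 f (f^`()%classic x).
  by apply: DeriveDef => //; rewrite derive1E.
have ds : is_derive x 1 (\sum_(k < m.+2) h k) (\sum_(k < m.+2) dh k) by exact: is_derive_sum.
rewrite (_ : taylor_rem m.+1 f s = f - \sum_(k < m.+2) h k); last first.
  by apply/funext => y; rewrite /taylor_rem !fctE fct_sumE.
apply: (is_derive_eq (is_deriveB df ds)); rewrite /taylor_rem; congr (_ - _).
rewrite big_ord_recl {1}/dh mul0r !mulr0 add0r; apply: eq_bigr => k _.
rewrite /dh lift0 derive1nSr factS natrM -[k.+1.-1]/(nat_of_ord k).
by field; rewrite nat1r !pnatr_eq0 -lt0n fact_gt0 ?add1n.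
Qed.

Lemma taylor_rem_center m f s : taylor_rem m f s s = 0.
Proof.
rewrite /taylor_rem big_ord_recl big1 => [|k _]; last first.
  by rewrite lift0 subrr expr0n !mulr0.
by rewrite addr0 fact0 invr1 mul1r expr0 mulr1 subrr.
Qed.

Definition convexR I := forall x y t, I x -> I y -> 0 <= t <= 1 -> I (x + t * (y - x)).

(** An integrated bound on the derivative without integrals: the mean value theorem
    on [0, 1], for [g] along the segment from [s] to [x] minus the expected power of
    the parameter. *)
Lemma growth I g dg (s D : R) n x : convexR I -> I s -> I x -> g s = 0 ->
  (forall y, I y -> is_derive y 1 g (dg y)) ->
  (forall y, I y -> `|dg y| <= D * `|y - s| ^+ n) ->
  `|g x| <= D * `|x - s| ^+ n.+1 / n.+1%:R.
Proof.
move=> cI Is Ix gs.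
set t := x - s.
suff main (k dk : R -> R) : k s = 0 -> (forall y, I y -> is_derive y 1 k (dk y)) ->
    (forall y, I y -> `|dk y| <= D * `|y - s| ^+ n) ->
    k x <= D * `|t| ^+ n.+1 / n.+1%:R.
  move=> dg1 dg2; rewrite ler_norml; apply/andP; split; last exact: main dg1 dg2.
  rewrite lerNl; apply: (main (- g) (- dg)).
  - by rewrite fctE gs oppr0.
  - by move=> y Iy; have := dg1 y Iy => h; apply: is_deriveN.
  - by move=> y Iy; rewrite fctE normrN; exact: dg2.
move=> ks dk1 dk2; set E := _ / _.
have It (a : R) : 0 <= a <= 1 -> I (s + a * t) by exact: cI.
pose K := (k \o (fun a => s + a * t)) - (E \*: (fun a => (a - 0) ^+ n.+1)).
pose dK a := dk (s + a * t) * t - E * (n.+1%:R * a ^+ n).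
have dKE (a : R) : 0 <= a <= 1 -> is_derive a 1 K (dK a).
  move=> a01.
  have d0 : is_derive a 1 (fun b : R => s + b * t) t.
    have := is_deriveD (is_derive_cst s a 1) (is_deriveZ t (is_derive_id a (1 : R))) => h.
    rewrite (_ : (fun b : R => s + b * t) = cst s + t \*: id); last first.
      by apply/funext => z; rewrite !fctE/= mulrC.
    by apply: (is_derive_eq h); rewrite add0r [LHS]mulr1.
  have d1 := @is_derive1_comp R k (fun b : R => s + b * t) a _ _ (dk1 _ (It _ a01)) d0.
  have d2 := is_deriveZ E (is_derive_pow 0 a n.+1).
  by apply: (is_derive_eq (is_deriveB d1 d2)); rewrite /dK subr0.
have [||c c01] := @MVT R K dK 0 1 ltr01.
- by move=> a; rewrite in_itv/= => /andP[a0 a1]; apply: dKE; rewrite !ltW.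
- apply: derivable_within_continuous => a; rewrite in_itv/= => /dKE h.
  exact: (@ex_derive _ _ _ _ _ _ _ h).
move: c01; rewrite in_itv/= => /andP[c0 c1].
have K0 : K 0 = 0.
  rewrite -[LHS]/(k (s + 0 * t) - E * (0 - 0) ^+ n.+1).
  by rewrite mul0r addr0 ks !subr0 expr0n mulr0 subr0.
have K1 : K 1 = k x - E.
  rewrite -[LHS]/(k (s + 1 * t) - E * (1 - 0) ^+ n.+1).
  by rewrite mul1r subr0 expr1n mulr1 /t subrKC.
rewrite K0 K1 !subr0 mulr1 => h; rewrite -subr_le0 h subr_le0.
have c01' : 0 <= c <= 1 by rewrite !ltW.
have := dk2 _ (It _ c01').
have -> : s + c * t - s = c * t by ring.
rewrite normrM (ger0_norm (ltW c0)) => h2.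
have h3 : dk (s + c * t) * t <= D * (c * `|t|) ^+ n * `|t|.
  by apply: (le_trans (ler_norm _)); rewrite normrM; exact: ler_wpM2r.
apply: (le_trans h3); rewrite le_eqVlt; apply/orP; left; apply/eqP.
by rewrite /E exprMn exprS; field; rewrite nat1r pnatr_eq0.
Qed.

(** The exponent [e = 0] serves for bounded and [e = 1] for Lipschitz
    derivatives. *)
Lemma taylor_bound I m f (s x C : R) e : convexR I -> I s -> I x ->
  times_differentiable_on m I f ->
  (forall y, I y -> `|f^`(m)%classic y - f^`(m)%classic s| <= C * `|y - s| ^+ e) ->
  `|taylor_rem m f s x| <= C * e`!%:R / (m + e)`!%:R * `|x - s| ^+ (m + e).
Proof.
move=> cI Is; elim: m f x => [|m IH] f x Ix df fC.
  rewrite /taylor_rem big_ord1 fact0 invr1 mul1r expr0 mulr1 add0n.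
  by rewrite mulfK ?pnatr_eq0 -?lt0n ?fact_gt0//; exact: fC.
have df' : times_differentiable_on m I (f^`())%classic.
  by move=> k km y Iy; rewrite -derive1nSr; exact: df.
have D1 y : I y -> is_derive y 1 (taylor_rem m.+1 f s) (taylor_rem m (f^`())%classic s y).
  by move=> Iy; apply: is_derive_taylor_rem; exact: (df 0%N (ltn0Sn m) y Iy).
have D2 y : I y -> `|taylor_rem m (f^`())%classic s y| <=
    C * e`!%:R / (m + e)`!%:R * `|y - s| ^+ (m + e).
  by move=> Iy; apply: IH => // z Iz; rewrite -derive1nSr; exact: fC.
have := growth cI Is Ix (taylor_rem_center _ _ _) D1 D2.
move=> /le_trans; apply; rewrite le_eqVlt; apply/orP; left; apply/eqP.
rewrite addSn factS natrM; field.
by rewrite -natrD nat1r !pnatr_eq0 -lt0n fact_gt0.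
Qed.

(** The value at [x = s] is 0 for every [m], the remainder being 0 there. *)
Definition taylor_quot (m : nat) f (s x : R) : R := taylor_rem m f s x / (x - s) ^+ m.

Lemma taylor_quotM m f s x : taylor_quot m f s x * (x - s) ^+ m = taylor_rem m f s x.
Proof.
have [->|xs] := eqVneq x s; last by rewrite divfK// expf_neq0// subr_eq0.
by rewrite /taylor_quot taylor_rem_center !mul0r.
Qed.

Lemma taylor_quot_center m f s : taylor_quot m f s s = 0.
Proof. by rewrite /taylor_quot taylor_rem_center mul0r. Qed.

Lemma taylor_quot_bound I m f (s x C : R) e : convexR I -> I s -> I x -> 0 <= C ->
  times_differentiable_on m I f ->
  (forall y, I y -> `|f^`(m)%classic y - f^`(m)%classic s| <= C * `|y - s| ^+ e) ->
  `|taylor_quot m f s x| <= C * e`!%:R / (m + e)`!%:R * `|x - s| ^+ e.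
Proof.
move=> cI Is Ix C0 df fC; have := taylor_bound cI Is Ix df fC.
have D0 : 0 <= C * e`!%:R / (m + e)`!%:R by rewrite divr_ge0// mulr_ge0.
have [->|xs] := eqVneq x s.
  by rewrite taylor_quot_center normr0 => _; rewrite mulr_ge0// exprn_ge0.
have p : 0 < `|x - s| ^+ m by rewrite exprn_gt0// normr_gt0 subr_eq0.
rewrite -taylor_quotM normrM normrX => h; rewrite -(ler_pM2r p).
by apply: (le_trans h); rewrite addnC exprD mulrA.
Qed.

(** A Lipschitz constant for the Taylor quotient when [F] is one for the [m]-th
    derivative. *)
Definition lip_quot (m : nat) (F : R) : R :=
  if m is m'.+1 then if m' is 0 then F / 2 else 2 * F / m`!%:R else F.

Section quot_lip.
Variables (I : set R) (m : nat) (f : R -> R) (s F : R).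
Hypotheses (cI : convexR I) (Is : I s) (F0 : 0 <= F).
Hypothesis df : times_differentiable_on m I f.
Hypothesis fF : forall x y, I x -> I y ->
  `|f^`(m)%classic x - f^`(m)%classic y| <= F * `|x - y|.

Lemma lip_quot_ge0 : 0 <= lip_quot m F.
Proof. by rewrite /lip_quot; case: m => [|[|k]]//; rewrite divr_ge0// mulr_ge0. Qed.

Let fFs y : I y -> `|f^`(m)%classic y - f^`(m)%classic s| <= F * `|y - s| ^+ 1.
Proof. by move=> Iy; rewrite expr1; exact: fF. Qed.

Lemma taylor_quot_lip_center x : I x -> `|taylor_quot m f s x| <= lip_quot m F * `|x - s|.
Proof.
move=> Ix; have := taylor_quot_bound cI Is Ix F0 df fFs.
move=> /le_trans; apply; rewrite expr1; apply: ler_wpM2r => //.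
rewrite -[1`!]/1%N mulr1 addn1 /lip_quot; case: m => [|[|k]]; rewrite ?divr1//.
rewrite [k.+3`!]factS natrM invfM mulrA ler_pM2r ?invr_gt0 ?ltr0n ?fact_gt0//.
rewrite ler_pdivrMr// mulrAC ler_peMl// -natrM ler1n//.
Qed.

(** For [m >= 2] the two terms of the derivative of the quotient are bounded
    separately, each by [F / m!].  For [m = 1] this would lose a factor; there the
    numerator is [f(s) - f(x) - (s - x) f'(x)], the first-order remainder of [f]
    expanded at [x] and evaluated at [s]. *)
Lemma taylor_quot_derive_bound x : (0 < m)%N -> I x -> x != s ->
  exists2 dq, is_derive x 1 (taylor_quot m f s) dq & `|dq| <= lip_quot m F.
Proof.
move=> m0 Ix xs.
case: m m0 df fFs fF => // k _ dk fks fk.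
have xs0 : x - s != 0 by rewrite subr_eq0.
pose r := taylor_rem k.+1 f s x; pose dr := taylor_rem k (f^`())%classic s x.
have d1 : is_derive x 1 (taylor_rem k.+1 f s) dr.
  by apply: is_derive_taylor_rem; exact: (dk 0%N (ltn0Sn k) x Ix).
have nz : (x - s) ^+ k.+1 != 0 by rewrite expf_neq0.
have d2 := is_deriveV (f := fun y => (y - s) ^+ k.+1) nz (is_derive_pow s x k.+1).
exists ((dr * (x - s) - k.+1%:R * r) / (x - s) ^+ k.+2).
  apply: (is_derive_eq (is_deriveM d1 d2)).
  rewrite -[LHS]/(r * (- ((x - s) ^+ k.+1) ^- 2 * (k.+1%:R * (x - s) ^+ k)) +
    ((x - s) ^+ k.+1)^-1 * dr).
  by rewrite !exprS; field; rewrite xs0 expf_neq0.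
have p : 0 < `|x - s| ^+ k.+2 by rewrite exprn_gt0// normr_gt0.
rewrite normrM normfV normrX ler_pdivrMr//.
case: k => [|k] in dk fks fk r dr d1 nz d2 p *.
  have -> : dr * (x - s) - 1%:R * r = taylor_rem 1 f x s.
    rewrite /dr /r /taylor_rem !big_ord_recl !big_ord0/= fact0 !invr1 /=.
    by rewrite !expr0 !expr1; ring.
  have := @taylor_bound I 1 f x s F 1 cI Ix Is dk _.
  move=> /(_ _)/le_trans; rewrite distrC; apply.
    by move=> y Iy; rewrite expr1; exact: fk.
  by rewrite /lip_quot -[1`!]/1%N mulr1.
have h1 : `|dr| <= F * 1`!%:R / (k.+1 + 1)`!%:R * `|x - s| ^+ (k.+1 + 1).
  apply: (taylor_bound cI Is Ix) => [j jk y Iy|y Iy].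
    by rewrite -derive1nSr; exact: dk.
  by rewrite -derive1nSr; exact: fks.
have h2 : `|r| <= F * 1`!%:R / (k.+2 + 1)`!%:R * `|x - s| ^+ (k.+2 + 1).
  exact: (taylor_bound cI Is Ix).
rewrite (le_trans (ler_normB _ _))// !normrM (ger0_norm (ler0n _ _)).
rewrite -[1`!]/1%N !addn1 mulr1 in h1 h2.
have := ler_wpM2r (normr_ge0 (x - s)) h1.
rewrite -[leRHS]mulrA -exprSr => h4.
have h3 := ler_wpM2l (ler0n R k.+2) h2.
apply: le_trans (lerD h4 h3) _.
rewrite [k.+2%:R * (_ * _)]mulrA -mulrDl; apply: ler_wpM2r; first exact: ltW.
rewrite /lip_quot [k.+3`!]factS natrM invfM.
have i0 : 0 <= F / k.+2`!%:R by rewrite divr_ge0.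
have : k.+2%:R * (F * (k.+3%:R^-1 * k.+2`!%:R^-1)) <= F / k.+2`!%:R.
  have -> : k.+2%:R * (F * (k.+3%:R^-1 * k.+2`!%:R^-1)) =
      F / k.+2`!%:R * (k.+2%:R / k.+3%:R) by ring.
  by rewrite ler_piMr// ler_pdivrMr// mul1r ler_nat.
have -> : 2 * F / k.+2`!%:R = F / k.+2`!%:R + F / k.+2`!%:R by ring.
by move=> h; apply: lerD.
Qed.

(** The mean value theorem applies when [s] is outside the segment from [x] to [y];
    otherwise the bound at the centre is used on either side of [s], where the two
    distances add up. *)
Lemma taylor_quot_lip x y : I x -> I y ->
  `|taylor_quot m f s x - taylor_quot m f s y| <= lip_quot m F * `|x - y|.
Proof.
have [m0|m0] := posnP m.
  move=> Ix Iy; rewrite /taylor_quot /taylor_rem m0 !big_ord1 !expr0 !divr1.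
  rewrite fact0 invr1 !mul1r !mulr1 opprB addrA subrK.
  by have := fF Ix Iy; rewrite m0.
wlog : x y / x <= y.
  move=> h Ix Iy; case: (leP x y) => [xy|/ltW yx]; first exact: h.
  by rewrite distrC [`|x - y|]distrC; exact: h.
rewrite le_eqVlt => /predU1P[-> _ _|xy Ix Iy]; first by rewrite !subrr normr0 mulr0.
have cx := taylor_quot_lip_center Ix; have cy := taylor_quot_lip_center Iy.
case: (boolP (x <= s <= y)) => [/andP[xs sy]|sN].
  apply: (le_trans (ler_normB _ _)); apply: (le_trans (lerD cx cy)).
  rewrite -mulrDr; apply: ler_wpM2l; first exact: lip_quot_ge0.
  rewrite ler0_norm ?subr_le0// ger0_norm ?subr_ge0// ltr0_norm ?subr_lt0//; lra.
have Iz z : x <= z <= y -> I z /\ z != s.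
  move=> /andP[xz zy]; split; last by apply: contra sN => /eqP <-; rewrite xz zy.
  have -> : z = x + (z - x) / (y - x) * (y - x) by rewrite divfK ?subrKC// subr_eq0 gt_eqF.
  apply: cI => //; rewrite divr_ge0 ?subr_ge0 ?(ltW xy)//=.
  by rewrite ler_pdivrMr ?subr_gt0// mul1r lerD2r.
pose q := taylor_quot m f s.
have dq z : x <= z <= y -> is_derive z 1 q (q^`()%classic z) /\ `|q^`()%classic z| <= lip_quot m F.
  move=> /Iz[Iz' zs]; have [d hd hb] := taylor_quot_derive_bound m0 Iz' zs.
  have -> : q^`()%classic z = d by rewrite derive1E; exact: derive_val.
  by [].
have [||c c01 E] := @MVT R q q^`()%classic x y xy.
- by move=> z; rewrite in_itv/= => /andP[z0 z1]; apply: (dq _ _).1; rewrite !ltW.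
- apply: derivable_within_continuous => z; rewrite in_itv/= => /dq[h _].
  exact: (@ex_derive _ _ _ _ _ _ _ h).
rewrite distrC -/q E normrM [`|x - y|]distrC; apply: ler_wpM2r => //.
by move: c01; rewrite in_itv/= => /andP[c0 c1]; apply: (dq _ _).2; rewrite !ltW.
Qed.

End quot_lip.

End taylor.

(** * Tensor powers, union bounds and dense sequences *)
Section algebra.
Context {R : realType}.

Lemma dotvE n (u v : 'cV[R]_n) : dotv u v = \sum_(j < n) u j 0 * v j 0.
Proof. by rewrite /dotv mxE; apply: eq_bigr => j _; rewrite mxE. Qed.

Lemma dotvBr n (u v w : 'cV[R]_n) : dotv u (v - w) = dotv u v - dotv u w.
Proof. by rewrite !dotvE -sumrB; apply: eq_bigr => j _; rewrite !mxE mulrBr. Qed.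

Lemma dotv_suml n (I : finType) (u : I -> 'cV[R]_n) (v : 'cV[R]_n) :
  dotv (\sum_i u i) v = \sum_i dotv (u i) v.
Proof.
rewrite dotvE; under eq_bigr do rewrite summxE mulr_suml.
by rewrite exchange_big/=; apply: eq_bigr => i _; rewrite dotvE.
Qed.

Lemma dotvZl n (a : R) (u v : 'cV[R]_n) : dotv (a *: u) v = a * dotv u v.
Proof. by rewrite !dotvE mulr_sumr; apply: eq_bigr => j _; rewrite mxE mulrA. Qed.

(** Stated entrywise since [1 ^ k] does not reduce to [1] for a variable [k]. *)
Lemma ntensmx_dot n (u v : 'cV[R]_n) k (j j' : 'I_(1 ^ k)) :
  ((u ^t k)^T *m (v ^t k)) j j' = dotv u v ^+ k.
Proof.
case: k j j' => [|k] j j'.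
  rewrite !ntensmx0 expr0 -[1%R in X in X *m _]/(1%:M) -[1%R in X in _ *m X]/(1%:M).
  by rewrite trmx1 mul1mx mxE !ord1.
elim: k j j' => [|k IH] j j'; first by rewrite !ntensmx1 expr1 /dotv !ord1.
rewrite !ntensmxSS trmx_tens tensmx_mul mxE IH [RHS]exprS; congr (_ * _).
by rewrite /dotv !ord1.
Qed.

Lemma dotv_tensor_pow n (u v : 'cV[R]_n) k :
  dotv (tensor_pow u k) (tensor_pow v k) = dotv u v ^+ k.
Proof.
rewrite dotvE -(ntensmx_dot u v (cast_ord (esym (exp1n k)) 0) (cast_ord (esym (exp1n k)) 0)).
by rewrite mxE; apply: eq_bigr => i _; rewrite /tensor_pow !castmxE mxE !cast_ord_id.
Qed.

Lemma expr_sum_ffun p m (a : 'I_p -> R) :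
  (\sum_j a j) ^+ m = \sum_(J : {ffun 'I_m -> 'I_p}) \prod_l a (J l).
Proof.
by rewrite -[in LHS](card_ord m) -prodr_const bigA_distr_bigA.
Qed.

Lemma prod_le_mean_pow m (a : 'I_m -> R) : (0 < m)%N -> (forall l, 0 <= a l) ->
  \prod_l a l <= m%:R^-1 * \sum_l a l ^+ m.
Proof.
move=> m0 a0.
have am l : 0 <= a l ^+ m by rewrite exprn_ge0.
have S0 : 0 <= m%:R^-1 * \sum_l a l ^+ m.
  by rewrite mulr_ge0 ?invr_ge0// sumr_ge0.
rewrite -(@ler_pXn2r _ m)// ?nnegrE ?prodr_ge0//.
rewrite -prodrXl.
have [+ _] := leif_AGM (A := predT) (E := fun l => a l ^+ m) (fun l _ => am l).
by rewrite cardT size_enum_ord mulrC.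
Qed.

End algebra.

Lemma mono_bound_bigcup {d} {T : measurableType d} {R : realType} (P : probability T R)
    (A : (set T)^nat) (c : \bar R) : (forall n, measurable (A n)) ->
  nondecreasing_seq A -> (forall n, (P (A n) <= c)%E) -> (P (\bigcup_n A n) <= c)%E.
Proof.
move=> mA ndA Ac.
have mU : measurable (\bigcup_n A n) by exact: bigcupT_measurable.
have cv := @nondecreasing_cvg_mu _ _ _ P _ mA mU ndA.
rewrite -(cvg_lim _ cv)//; apply: lime_le; first by apply/cvg_ex; eexists; exact: cv.
by near=> n; exact: Ac.
Unshelve. all: by end_near. Qed.

Lemma boole_fin {d} {T : measurableType d} {R : realType} (P : probability T R)
    (I : finType) (A : I -> set T) (E : set T) : (forall i, measurable (A i)) ->
  measurable E -> E `<=` \bigcup_i A i -> (P E <= \sum_i P (A i))%E.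
Proof.
move=> mA mE EA.
have mU (s : seq I) : measurable (\big[setU/set0]_(i <- s) A i) by exact: bigsetU_measurable.
apply: (@le_trans _ _ (P (\big[setU/set0]_i A i))).
  apply: le_measure; rewrite ?inE// => w /EA[i _ Aw].
  by rewrite -bigcup_seq; exists i => //=; rewrite mem_index_enum.
elim: (index_enum I) => [|i s IH]; first by rewrite !big_nil measure0.
rewrite !big_cons; apply: (le_trans (measureU2 _ _ _)) => //.
by rewrite leeD2l.
Qed.

(** [b @` D] is separable as a subset of [R^N]: for each ball with rational centre
    and radius [1/n] pick a point of [D] mapped into it, when there is one. *)
Lemma dense_seq {R : realType} {T : Type} (N : nat) (D : set T) (b : T -> 'I_N -> R) :
  D !=set0 -> exists v : nat -> T, (forall k, D (v k)) /\
    forall x e, D x -> 0 < e -> exists k, forall i, `|b x i - b (v k) i| < e.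
Proof.
move=> [x0 Dx0].
pose good (c : {ffun 'I_N -> rat} * nat) (x : T) :=
  D x /\ forall i, `|b x i - ratr (c.1 i)| < c.2.+1%:R^-1.
have pick (c : {ffun 'I_N -> rat} * nat) : {x | D x /\ ((exists y, good c y) -> good c x)}.
  have [/cid[y gy]|nx] := pselect (exists y, good c y).
    by exists y; split => //; case: gy.
  by exists x0; split.
exists (fun k => sval (pick (odflt ([ffun=> 0], 0%N) (unpickle k)))).
split=> [k|x e Dx e0]; first by case: (pick _) => y /= [].
have e2 : 0 < e / 2 by rewrite divr_gt0.
have [n ne] : exists n : nat, n.+1%:R^-1 < e / 2.
  have [n] := ltr_add_invr e2; rewrite add0r => h; by exists n.
have n0 : 0 < n.+1%:R^-1 :> R by rewrite invr_gt0.
have hr i : {r : rat | `|b x i - ratr r| < n.+1%:R^-1}.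
  apply: cid; have h : b x i - n.+1%:R^-1 < b x i + n.+1%:R^-1 by rewrite ltrD2l gtrN.
  have [r] := rat_in_itvoo h; rewrite in_itv/= => /andP[h1 h2].
  by exists r; rewrite distrC ltr_distl h1 h2.
pose c : {ffun 'I_N -> rat} * nat := ([ffun i => sval (hr i)], n).
have gx : good c x.
  by split => // i /=; rewrite ffunE; case: (hr i).
exists (pickle c) => i; rewrite pickleK/=; case: (pick c) => y /= [Dy].
case; first by exists x.
move=> _ /(_ i) /= hy; have [_ /(_ i) /= hx] := gx.
move: hy hx; rewrite ffunE; set r := ratr _ => hy hx.
have -> : b x i - b y i = (b x i - r) - (b y i - r) by ring.
apply: (le_lt_trans (ler_normB _ _)); rewrite (splitr e).
by apply: ltrD; [exact: lt_trans ne|exact: lt_trans ne].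
Qed.

(** * The remainder process *)
Section process.
Context {d : measure_display} {T : measurableType d} {R : realType}.
Variables (P : probability T R) (N p m : nat).
Variables (om : 'I_N -> {RV P >-> R}) (sigma : R).
Hypothesis om_indep : mutually_independent om.
Hypothesis sigma0 : 0 < sigma.
Hypothesis om_gauss : forall i, centered_gaussian sigma (om i).
Hypothesis p0 : (0 < p)%N.
Variables (x : 'I_N -> 'cV[R]_p) (f : 'I_N -> R -> R) (I : 'I_N -> set R).
Variables (D : set 'cV[R]_p) (theta : 'cV[R]_p).
Hypothesis d0 : forall j, 0 < scale x j.
Hypothesis cI : forall i, convexR (I i).
Hypothesis DI : forall v, D v -> forall i, I i (dotv (x i) v).
Hypothesis Dtheta : D theta.
Hypothesis df : forall i, times_differentiable_on m (I i) (f i).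
Variables F Fm : R.
Hypothesis F0 : 0 <= F.
Hypothesis Fm0 : 0 <= Fm.
Hypothesis fF : forall i s t, I i s -> I i t ->
  `|(f i)^`(m)%classic s - (f i)^`(m)%classic t| <= F * `|s - t|.
Hypothesis fFm : forall i t, I i t -> `|(f i)^`(m)%classic t| <= Fm.

Notation rvec := (rvec om).

(** In these coordinates the weight is the [l^1] norm of [shift v] and all covariates
    are bounded by 1. *)
Definition unit_cov j i := x i j 0 / scale x j.
Definition shift (v : 'cV[R]_p) j := scale x j * (v j 0 - theta j 0).
Let e := unit_cov.
Let u := shift.
Let s i := dotv (x i) theta.
Let quot (v : 'cV[R]_p) i := taylor_quot m (f i) (s i) (dotv (x i) v).
Let V k := scaled_moment x k.

(** Division by a zero weight gives 0; the remainder vanishes in that case, so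
    [xi_coefM] needs no exception. *)
Definition xi_coef (v : 'cV[R]_p) i := taylor_rem m (f i) (s i) (dotv (x i) v) / wl1 x v theta ^+ m.

(** The coefficient of [prod_l u_(J l)] in the expansion of the remainder. *)
Definition multi_coef (J : {ffun 'I_m -> 'I_p}) v i :=
  quot v i * \prod_l e (J l) i.

Lemma incrE v i : dotv (x i) v - s i = \sum_j e j i * u v j.
Proof.
rewrite /s -dotvBr dotvE; apply: eq_bigr => j _.
by rewrite /e /u /unit_cov /shift !mxE; field; rewrite gt_eqF.
Qed.

Lemma wl1E v : wl1 x v theta = \sum_j `|u v j|.
Proof.
by apply: eq_bigr => j _; rewrite /u /shift normrM ger0_norm// ltW.
Qed.

Lemma unit_cov_le1 j i : `|e j i| <= 1.
Proof.
rewrite /e /unit_cov normrM normfV (gtr0_norm (d0 j)) ler_pdivrMr// mul1r.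
exact: (le_max0 (fun i => `|x i j 0|)).
Qed.

Lemma wl1_ge0 v : 0 <= wl1 x v theta.
Proof. by rewrite wl1E sumr_ge0. Qed.

Lemma incr_le v i : `|dotv (x i) v - s i| <= wl1 x v theta.
Proof.
rewrite incrE wl1E; apply: (le_trans (ler_norm_sum _ _ _)).
by apply: ler_sum => j _; rewrite normrM ler_piMl// unit_cov_le1.
Qed.

Lemma xi_coefM v i :
  xi_coef v i * wl1 x v theta ^+ m = taylor_rem m (f i) (s i) (dotv (x i) v).
Proof.
have [w0|w0] := eqVneq (wl1 x v theta ^+ m) 0; last by rewrite /xi_coef divfK.
move/eqP: w0; rewrite expf_eq0 => /andP[m0 /eqP w0].
have := incr_le v i; rewrite w0 normr_le0 subr_eq0 => /eqP ->.
by rewrite taylor_rem_center expr0n gtn_eqF// mulr0.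
Qed.

(** The remainders are the sums over [J] of [prod_l u_(J l)] times the linear forms
    of [multi_coef J v], and the products have total absolute mass
    [(sum_j |u_j|)^m], the quantity that [xi_coef] divides by. *)
Lemma xi_le_multi v M o : 0 <= M -> (forall J, `|lin (multi_coef J v) o| <= M) ->
  `|lin (xi_coef v) o| <= M.
Proof.
move=> M0 JM.
have [w0|w0] := eqVneq (wl1 x v theta ^+ m) 0.
  rewrite /lin big1 ?normr0// => i _.
  by rewrite /xi_coef w0 invr0 mulr0 mul0r.
have wp : 0 < wl1 x v theta ^+ m.
  by rewrite lt_neqAle eq_sym w0 exprn_ge0// wl1_ge0.
rewrite -(ler_pM2r wp) -[X in _ * X <= _](ger0_norm (ltW wp)) -normrM.
have -> : lin (xi_coef v) o * wl1 x v theta ^+ m =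
    \sum_(J : {ffun 'I_m -> 'I_p}) (\prod_l u v (J l)) * lin (multi_coef J v) o.
  rewrite /lin mulr_suml; under [RHS]eq_bigr do rewrite mulr_sumr.
  rewrite exchange_big/=; apply: eq_bigr => i _.
  rewrite mulrAC xi_coefM -taylor_quotM incrE expr_sum_ffun mulr_sumr mulr_suml.
  apply: eq_bigr => J _; rewrite big_split/= /multi_coef /quot; ring.
rewrite wl1E expr_sum_ffun mulrC mulr_suml; apply: (le_trans (ler_norm_sum _ _ _)).
apply: ler_sum => J _; rewrite normrM normr_prod.
by apply: ler_wpM2l => //; exact: prodr_ge0.
Qed.

Let Itheta i : I i (s i). Proof. exact: DI. Qed.

Lemma quot_le_bound v i : D v -> `|quot v i| <= 2 * Fm / m`!%:R.
Proof.
move=> Dv.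
have h y : I i y -> `|(f i)^`(m)%classic y - (f i)^`(m)%classic (s i)| <=
    2 * Fm * `|y - s i| ^+ 0.
  move=> Iy; rewrite expr0 mulr1; apply: (le_trans (ler_normB _ _)).
  have := fFm Iy; have := fFm (Itheta i); lra.
have F20 : 0 <= 2 * Fm by rewrite mulr_ge0.
have := taylor_quot_bound (@cI i) (Itheta i) (DI Dv i) F20 (@df i) h.
by rewrite expr0 fact0 !mulr1 addn0.
Qed.

Lemma quot_le_lip v i : D v -> `|quot v i| <= F / m.+1`!%:R * wl1 x v theta.
Proof.
move=> Dv.
have h y : I i y -> `|(f i)^`(m)%classic y - (f i)^`(m)%classic (s i)| <=
    F * `|y - s i| ^+ 1.
  by move=> Iy; rewrite expr1; exact: fF.
have := taylor_quot_bound (@cI i) (Itheta i) (DI Dv i) F0 (@df i) h.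
rewrite expr1 -[1`!]/1%N mulr1 addn1 => /le_trans; apply.
by apply: ler_wpM2l; [rewrite divr_ge0|exact: incr_le].
Qed.

Lemma xi_coef_eq0 v i : quot v i = 0 -> xi_coef v i = 0.
Proof. by move=> q0; rewrite /xi_coef -taylor_quotM -/(quot v i) q0 !mul0r. Qed.

Lemma moment_ge j k : \sum_i e j i ^+ k <= V k.
Proof. exact: (le_max0 (fun j => \sum_i (x i j 0 / scale x j) ^+ k)). Qed.

Lemma moment_gt0 k : ~~ odd k -> 0 < V k.
Proof.
move=> ek; pose j := Ordinal p0; apply: lt_le_trans (moment_ge j k).
have [|i] := @lt_max0 R _ (fun i => `|x i j 0|) 0 _ (d0 j); first by [].
rewrite normr_gt0 => xi0.
rewrite (bigD1 i)//=; apply: ltr_wpDr; first by apply: sumr_ge0 => l _; exact: exprn_even_ge0.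
rewrite lt_neqAle exprn_even_ge0// eq_sym expf_neq0//.
by rewrite /e /unit_cov mulf_neq0// invr_neq0// gt_eqF.
Qed.

(** The arithmetic-geometric inequality replaces the mixed moment of the columns
    [J l] by the average of their moments of order [2 m]. *)
Lemma multi_coef_sqr J v ph : (forall i, `|quot v i| <= ph) ->
  \sum_i multi_coef J v i ^+ 2 <= ph ^+ 2 * V (2 * m).
Proof.
move=> qph.
apply: (@le_trans _ _ (ph ^+ 2 * \sum_i \prod_l e (J l) i ^+ 2)).
  rewrite mulr_sumr; apply: ler_sum => i _.
  rewrite /multi_coef exprMn prodrXl; apply: ler_wpM2r; first exact: sqr_ge0.
  by rewrite -real_normK ?num_real// lerXn2r ?nnegrE// (le_trans _ (qph i)).
apply: ler_wpM2l; first exact: sqr_ge0.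
have [m0|m0] := posnP m.
  apply: le_trans (moment_ge (Ordinal p0) _); apply: ler_sum => i _.
  rewrite big1 => [|l _]; last by have := ltn_ord l; rewrite {2}m0.
  by rewrite m0 muln0 expr0.
apply: (@le_trans _ _ (m%:R^-1 * \sum_(l < m) V (2 * m))); last first.
  by rewrite sumr_const card_ord -[V _ *+ m]mulr_natl mulKf// pnatr_eq0 -lt0n.
apply: (@le_trans _ _ (\sum_i (m%:R^-1 * \sum_l e (J l) i ^+ (2 * m)))).
  apply: ler_sum => i _.
  have := @prod_le_mean_pow _ m (fun l => e (J l) i ^+ 2) m0 (fun l => sqr_ge0 _).
  by under [X in _ * X]eq_bigr do rewrite -exprM.
rewrite -mulr_sumr; apply: ler_wpM2l; first by rewrite invr_ge0.
rewrite exchange_big; apply: ler_sum => l _; exact: moment_ge.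
Qed.

Lemma multi_coef_le J v i : D v ->
  `|multi_coef J v i| <= lip_quot m F * `|\sum_j e j i * u v j|.
Proof.
move=> Dv; rewrite -incrE normrM normr_prod.
apply: (le_trans _ (taylor_quot_lip_center (@cI i) (Itheta i) F0 (@df i) (@fF i) (DI Dv i))).
by apply: ler_piMr => //; apply: prodr_ile1 => l _; rewrite normr_ge0 unit_cov_le1.
Qed.

Lemma multi_coef_lip J v v' i : D v -> D v' ->
  `|multi_coef J v i - multi_coef J v' i| <=
    lip_quot m F * `|\sum_j e j i * u v j - \sum_j e j i * u v' j|.
Proof.
move=> Dv Dv'; rewrite -!incrE -mulrBl normrM normr_prod.
have -> : dotv (x i) v - s i - (dotv (x i) v' - s i) = dotv (x i) v - dotv (x i) v' by ring.
apply: (le_trans _ (taylor_quot_lip (@cI i) (Itheta i) F0 (@df i) (@fF i) (DI Dv i) (DI Dv' i))).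
by apply: ler_piMr => //; apply: prodr_ile1 => l _; rewrite normr_ge0 unit_cov_le1.
Qed.

Lemma measurable_lin_rvec c : measurable_fun setT (fun w => lin c (rvec w)).
Proof. exact: (measurableT_comp (measurable_lin c) (measurable_rvec om)). Qed.

Lemma measurable_gt (g : T -> R) (tau : R) : measurable_fun setT g ->
  measurable [set w | tau < g w].
Proof.
move=> mg.
have : measurable_fun setT (fun w => tau < g w).
  by apply: measurable_fun_ltr => //; exact: measurable_cst.
by move=> /(_ measurableT [set true]); rewrite setTI; exact.
Qed.

Lemma measurable_abs_lin c : measurable_fun setT (fun w => `|lin c (rvec w)|).
Proof. by apply: measurableT_comp => //; exact: measurable_lin_rvec. Qed.

Definition exceed tau := [set w | exists2 v, D v & tau < `|lin (xi_coef v) (rvec w)|].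

(** For a fixed outcome the linear form is continuous in its coefficient vector, and
    a strict excess persists at a close enough member of the sequence. *)
Lemma exceed_seq : exists v : nat -> 'cV[R]_p, (forall k, D (v k)) /\
  forall tau, exceed tau = \bigcup_k [set w | tau < `|lin (xi_coef (v k)) (rvec w)|].
Proof.
have [v [Dv dv]] := @dense_seq R _ N D xi_coef (ex_intro _ theta Dtheta).
exists v; split => // tau; apply/seteqP; split => w /=; last first.
  by move=> [k _ hk]; exists (v k).
move=> [y Dy hy].
pose g := `|lin (xi_coef y) (rvec w)| - tau.
pose S := 1 + \sum_i `|tnth (rvec w) i|.
have S0 : 0 < S by rewrite ltr_pwDl// sumr_ge0.
have g0 : 0 < g / S by rewrite divr_gt0// subr_gt0.
have [k hk] := dv y _ Dy g0; exists k => //=.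
have h : `|lin (xi_coef y) (rvec w) - lin (xi_coef (v k)) (rvec w)| < g.
  rewrite /lin -sumrB.
  apply: (@le_lt_trans _ _ (\sum_i g / S * `|tnth (rvec w) i|)).
    apply: (le_trans (ler_norm_sum _ _ _)); apply: ler_sum => i _.
    by rewrite -mulrBl normrM; apply: ler_wpM2r => //; rewrite ltW.
  rewrite -mulr_sumr -[ltRHS](@divfK _ S) ?gt_eqF// ltr_pM2l//.
  by rewrite /S ltrDr.
by have := le_lt_trans (lerB_dist _ _) h; rewrite ltrD2l ltrN2.
Qed.

Lemma measurable_exceed tau : measurable (exceed tau).
Proof.
have [v [_ ->]] := exceed_seq.
apply: bigcupT_measurable => k; apply: measurable_gt; exact: measurable_abs_lin.
Qed.

(** Along the dense sequence, the event for each multi-index is an increasing union of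
    events for finite families, to which [finite_deviation] applies with the error
    probability [q / p^m]. *)
Lemma exceed_prob (ph Q q : R) : 0 < ph -> 0 <= Q ->
  (forall v, D v -> forall i, `|quot v i| <= ph) ->
  (forall v, D v -> wl1 x v theta <= Q) -> 0 < q < 1 ->
  (P (exceed (2 * (lip_quot m F * Q *
      (sigma * Num.sqrt (V 2) * Num.sqrt (2 * ln (2 * p)%:R))) +
    sigma * Num.sqrt (ph ^+ 2 * V (2 * m)) * Num.sqrt (2 * ln (p%:R ^+ m / q)))%R)
   <= q%:E)%E.
Proof.
move=> ph0 Q0 qph wQ /andP[q0 q1]; set tau := (X in exceed X).
have tau0 : 0 <= tau.
  by rewrite /tau addr_ge0// !mulr_ge0 ?lip_quot_ge0// ltW.
have pm1 : 1 <= p%:R ^+ m :> R by rewrite exprn_ege1// ler1n.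
have pm0 : 0 < p%:R ^+ m :> R by exact: lt_le_trans pm1.
pose q' := q / p%:R ^+ m.
have q'01 : 0 < q' < 1.
  rewrite divr_gt0//= ltr_pdivrMr// mul1r; exact: lt_le_trans pm1.
have [v [Dv vE]] := exceed_seq.
pose Y J w n := max0 (fun k : 'I_n => `|lin (multi_coef J (v k)) (rvec w)|).
pose A J n := [set w | tau < Y J w n].
have mA J n : measurable (A J n).
  apply: measurable_gt.
  apply: (measurable_max0 (F := fun (k : 'I_n) w => `|lin (multi_coef J (v k)) (rvec w)|)) => k.
  exact: measurable_abs_lin.
have PA J n : (P (A J n) <= q'%:E)%E.
  (* each multi-index gets an equal share [q'] of the probability *)
  have := @finite_deviation _ _ _ P N om sigma om_indep sigma0 om_gauss
    'I_n p e (fun k i => multi_coef J (v k) i) (fun k j => u (v k) j)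
    (lip_quot m F) Q (ph ^+ 2 * V (2 * m)) (V 2) p0 (lip_quot_ge0 m F0) Q0.
  move=> /(_ _ _ _ _ _ _ _ q' q'01).
  rewrite {1}/q' invf_div => h; apply: h.
  - by rewrite mulr_gt0 ?exprn_gt0// moment_gt0// oddM.
  - exact: moment_gt0.
  - by move=> j; exact: moment_ge.
  - by move=> k i; exact: multi_coef_le.
  - by move=> k k' i; exact: multi_coef_lip.
  - by move=> k; rewrite -wl1E; exact: wQ.
  - by move=> k; apply: multi_coef_sqr => i; exact: qph.
have PU J : (P (\bigcup_n A J n) <= q'%:E)%E.
  apply: mono_bound_bigcup => // n n' nn'; apply/subsetPset => w /= h.
  apply: (lt_le_trans h); apply: max0_le => [|k]; first exact: max0_ge0.
  exact: (le_max0 (fun k : 'I_n' => `|lin (multi_coef J (v k)) (rvec w)|) (widen_ord nn' k)).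
have sub : exceed tau `<=` \bigcup_J \bigcup_n A J n.
  rewrite vE => w [k _ /= hk].
  apply: contrapT => nA; move: hk; apply/negP; rewrite -leNgt.
  apply: xi_le_multi => // J; rewrite leNgt; apply/negP => hJ.
  apply: nA; exists J => //; exists k.+1 => //=; apply: (lt_le_trans hJ).
  exact: (le_max0 (fun k : 'I_k.+1 => `|lin (multi_coef J (v k)) (rvec w)|) ord_max).
have mU J : measurable (\bigcup_n A J n) by exact: bigcupT_measurable.
apply: (le_trans (boole_fin P mU (measurable_exceed tau) sub)).
apply: (@le_trans _ _ (\sum_(J : {ffun 'I_m -> 'I_p}) q'%:E)%E).
  by apply: lee_sum => J _; exact: PU.
rewrite sumEFin lee_fin sumr_const card_ffun !card_ord -[q' *+ _]mulr_natr natrX.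
by rewrite /q' divfK// gt_eqF.
Qed.

End process.

(** * Extended-real constants *)
Section constants.
Context {R : realType}.
Implicit Types (I : set R) (g : R -> R).

Lemma eoo_convex (a b : \bar R) : convexR (eoo a b).
Proof.
move=> x y t; rewrite /eoo/= => /andP[ax xb] /andP[ay yb] /andP[t0 t1].
have h1 : x + t * (y - x) <= Num.max x y.
  case: (leP x y) => xy; last have yx := ltW xy.
    by rewrite -lerBrDl ler_piMl// subr_ge0.
  by rewrite -lerBrDl subrr mulr_ge0_le0// subr_le0.
have h2 : Num.min x y <= x + t * (y - x).
  case: (leP x y) => xy; last have yx := ltW xy.
    by rewrite -lerBlDl subrr mulr_ge0// subr_ge0.
  by nra.
apply/andP; split.
  apply: (@lt_le_trans _ _ (Num.min x y)%:E); last by rewrite lee_fin.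
  by rewrite /Num.min; case: ifP.
apply: (@le_lt_trans _ _ (Num.max x y)%:E); first by rewrite lee_fin.
by rewrite /Num.max; case: ifP.
Qed.

(** The Lipschitz constant is a supremum over pairs of distinct points, and such a
    pair is needed for it to be nonnegative. *)
Lemma eoo_other (a b : \bar R) s : eoo a b s -> exists2 t, eoo a b t & s != t.
Proof.
rewrite /eoo/= => /andP[sa]; case: b => [b| |]//; last first.
  move=> _; exists (s + 1); last by rewrite -subr_eq0 opprD addNKr oppr_eq0 oner_eq0.
  by rewrite /= ltry andbT (lt_trans sa)// lte_fin ltrDl.
rewrite lte_fin => sb; exists ((s + b) / 2); last by rewrite lt_eqF// midf_lt.
by rewrite /= lte_fin midf_lt// andbT (lt_trans sa)// lte_fin midf_lt.
Qed.

Lemma sup_norm_fin I g : I !=set0 -> [bounded g t | t in I] ->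
  exists c, [/\ 0 <= c, sup_norm_on I g = c%:E & forall t, I t -> `|g t| <= c].
Proof.
move=> [t0 It0] /pinfty_ex_gt0[M M0 gM].
have ub t : I t -> (`|g t|%:E <= sup_norm_on I g)%E.
  by move=> It; apply: ereal_sup_ubound; exists t.
have le : (sup_norm_on I g <= M%:E)%E.
  by apply: ge_ereal_sup => _ [t It <-]; rewrite lee_fin; exact: gM.
move: ub le; case: (sup_norm_on I g) => [c| |] ub le.
- exists c; split => [|//|t It]; last by have := ub t It; rewrite lee_fin.
  by have := ub t0 It0; rewrite lee_fin; exact: le_trans.
- by have := le; rewrite leye_eq.
- by have := ub _ It0; rewrite leeNy_eq.
Qed.

Lemma lip_norm_fin I g s t : I s -> I t -> s != t -> [lipschitz g t | t in I] ->
  exists c, [/\ 0 <= c, lip_norm_on I g = c%:E &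
    forall s t, I s -> I t -> `|g s - g t| <= c * `|s - t|].
Proof.
move=> Is It st /pinfty_ex_gt0[M M0 gM].
have ub a b : I a -> I b -> a != b -> ((`|g a - g b| / `|a - b|)%:E <= lip_norm_on I g)%E.
  by move=> Ia Ib ab; apply: ereal_sup_ubound; exists (a, b).
have le : (lip_norm_on I g <= M%:E)%E.
  apply: ge_ereal_sup => _ [[a b] /= [Ia Ib ab] <-]; rewrite lee_fin.
  by rewrite ler_pdivrMr ?normr_gt0 ?subr_eq0//; exact: (gM (a, b)).
move: ub le; case: (lip_norm_on I g) => [c| |] ub le.
- exists c; split => [|//|a b Ia Ib].
    by have := ub s t Is It st; rewrite lee_fin; apply: le_trans; rewrite divr_ge0.
  have [->|ab] := eqVneq a b; first by rewrite !subrr normr0 mulr0.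
  rewrite -ler_pdivrMr ?normr_gt0 ?subr_eq0//; have := ub a b Ia Ib ab.
  by rewrite lee_fin.
- by have := le; rewrite leye_eq.
- by have := ub s t Is It st; rewrite leeNy_eq.
Qed.

Lemma bigmaxe_fin N (G : 'I_N -> \bar R) (c : 'I_N -> R) : (0 < N)%N ->
  (forall i, 0 <= c i) -> (forall i, G i = (c i)%:E) ->
  exists C, [/\ 0 <= C, \big[maxe/-oo%E]_(i < N) G i = C%:E & forall i, c i <= C].
Proof.
move=> N0 c0 Gc; set S := (\big[_/_]_(_ < _) _).
have ub i : ((c i)%:E <= S)%E by rewrite -Gc; exact: le_bigmax.
have le : (S <= (max0 c)%:E)%E.
  by apply: bigmax_le => [|i _]; rewrite ?leNye// Gc lee_fin; exact: le_max0.
move: ub le; case: S => [C| |] ub le.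
- exists C; split => [|//|i]; last by have := ub i; rewrite lee_fin.
  by have := ub (Ordinal N0); rewrite lee_fin; exact: le_trans.
- by have := le; rewrite leye_eq.
- by have := ub (Ordinal N0); rewrite leeNy_eq.
Qed.

Lemma lip_quot_le_psi m (F : R) : 0 <= F ->
  lip_quot m F <= 2 * (if m == 1%N then F / 2 else F / m`!%:R).
Proof.
move=> F0; rewrite /lip_quot; case: m => [|[|m]] /=.
- by rewrite fact0 divr1 ler_peMl// ler1n.
- by rewrite ler_peMl ?ler1n// divr_ge0.
- by rewrite mulrA.
Qed.

(** The factor 8 of the mean term is [2 * 2 * 2]: one factor for the two signs of the
    linear forms, one for [lip_quot] against [psi], and one for [sqrt 2 <= 2]. *)
Lemma threshold_le (L ps Q S1 s sg V ph l2 lq : R) :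
  0 <= Q -> 0 <= S1 -> 0 <= sg -> L <= 2 * ps -> 0 <= L -> 0 <= ph ->
  0 <= V -> 0 <= l2 ->
  2 * (L * Q * (sg * S1 * Num.sqrt (2 * l2))) +
    sg * Num.sqrt (ph ^+ 2 * V) * lq <=
  sg * (8 * ps * Q * S1 * Num.sqrt l2 + ph * Num.sqrt V * lq).
Proof.
move=> Q0 S10 sg0 Lps L0 ph0 V0 l20.
rewrite sqrtrM// sqrtrM ?sqr_ge0// sqrtr_sqr ger0_norm//.
have s2 : Num.sqrt 2 <= 2 :> R.
  by rewrite -(@ler_pXn2r _ 2%N)// ?nnegrE ?sqrtr_ge0// sqr_sqrtr//; lra.
set X := sg * Q * S1 * Num.sqrt l2.
have X0 : 0 <= X by rewrite !mulr_ge0 ?sqrtr_ge0.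
have h : L * Num.sqrt 2 * X <= 2 * ps * 2 * X.
  by apply: ler_wpM2r => //; apply: ler_pM; rewrite ?sqrtr_ge0.
have -> : sg * (8 * ps * Q * S1 * Num.sqrt l2 + ph * Num.sqrt V * lq) =
  2 * (2 * ps * 2 * X) + sg * (ph * Num.sqrt V) * lq by rewrite /X; ring.
have -> : 2 * (L * Q * (sg * S1 * (Num.sqrt 2 * Num.sqrt l2))) =
  2 * (L * Num.sqrt 2 * X) by rewrite /X; ring.
by rewrite lerD2r; apply: ler_wpM2l.
Qed.

End constants.

(** * The expansion and its deviation bound *)
Theorem theorem2p3
  (R : realType) (dO : measure_display) (Omega : measurableType dO)
  (P : probability Omega R)
  (dZ : measure_display) (ZT : measurableType dZ)
  (N p m : nat) (N_gt0 : (0 < N)%N) (p_gt0 : (0 < p)%N)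
  (Z : 'I_N -> ZT) (h : ZT -> 'cV[R]_p)
  (h_meas : forall j : 'I_p, measurable_fun setT (fun z => h z j 0))
  (d_gt0 : forall j : 'I_p, 0 < scale (fun i => h (Z i)) j)
  (f : 'I_N -> R -> R) (a b : 'I_N -> \bar R)
  (ab : forall i, (a i < b i)%E)
  (f_diff : forall i, times_differentiable_on m (eoo (a i) (b i)) (f i))
  (f_bounded : forall i,
     [bounded (f i)^`(m)%classic t | t in eoo (a i) (b i)])
  (f_lip : forall i,
     [lipschitz (f i)^`(m)%classic t | t in eoo (a i) (b i)])
  (D0 : set 'cV[R]_p) (D0_neq0 : D0 !=set0)
  (D0_dom : forall v, D0 v -> forall i, eoo (a i) (b i) (dotv (h (Z i)) v))
  (sigma0 : R) (sigma0_gt0 : 0 < sigma0)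
  (omega : 'I_N -> {RV P >-> R})
  (omega_indep : mutually_independent omega)
  (omega_L2 : forall i, (omega i : Omega -> R) \in Lfun P 2%:E)
  (omega_mean : forall i, ('E_P[omega i] = 0)%E)
  (omega_gauss : forall i, gaussian_rv (omega i))
  (omega_var : forall i, (variance P (omega i) <= (sigma0 ^+ 2)%:E)%E)
  (theta : 'cV[R]_p) (theta_D0 : D0 theta) :
  exists xi : 'cV[R]_p -> {RV P >-> R},
    (forall v, D0 v -> forall w : Omega,
       \sum_(i < N) omega i w * f i (dotv (h (Z i)) v) =
         \sum_(k < m.+1) (k`!%:R)^-1 *
           (\sum_(i < N) omega i w * (f i)^`(k)%classic (dotv (h (Z i)) theta)
                         * dotv (h (Z i)) (v - theta) ^+ k)
         + xi v w * (wl1 (fun i => h (Z i)) v theta) ^+ m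
       /\
       \sum_(i < N) omega i w * f i (dotv (h (Z i)) v) =
         \sum_(k < m.+1) (k`!%:R)^-1 *
           dotv (\sum_(i < N)
                   (omega i w * (f i)^`(k)%classic (dotv (h (Z i)) theta))
                     *: tensor_pow (h (Z i)) k)
                (tensor_pow (v - theta) k)
         + xi v w * (wl1 (fun i => h (Z i)) v theta) ^+ m)
    /\
    (forall q : R, 0 < q < 1 ->
       let E := [set w : Omega |
         (threshold m (fun i => eoo (a i) (b i)) f (fun i => h (Z i)) D0 sigma0 q
          < ereal_sup [set (`|xi v w|)%:E | v in D0])%E] in
       measurable E /\ (P E <= q%:E)%E).
Proof.
pose x i := h (Z i); pose I i := eoo (a i) (b i).
have gauss i : centered_gaussian sigma0 (omega i) by exact: gaussian_rv_centered.
have cI i : convexR (I i) by exact: eoo_convex.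
have DI v : D0 v -> forall i, I i (dotv (x i) v) by exact: D0_dom.
have fb i : {c | [/\ 0 <= c, sup_norm_on (I i) ((f i)^`(m)%classic) = c%:E
    & forall t, I i t -> `|(f i)^`(m)%classic t| <= c]}.
  by apply: cid; apply: sup_norm_fin => //; exists (dotv (x i) theta); exact: DI.
have fl i : {c | [/\ 0 <= c, lip_norm_on (I i) ((f i)^`(m)%classic) = c%:E
    & forall s t, I i s -> I i t ->
        `|(f i)^`(m)%classic s - (f i)^`(m)%classic t| <= c * `|s - t|]}.
  apply: cid; have [t It st] := eoo_other (DI _ theta_D0 i).
  exact: (lip_norm_fin (DI _ theta_D0 i) It st (@f_lip i)).
have [Fm [Fm0 FmE Fmle]] : exists C, [/\ 0 <= C, Fbound m I f = C%:E
    & forall i, sval (fb i) <= C].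
  by apply: bigmaxe_fin => // i; case: (fb i) => c [].
have [F [F0 FE Fle]] : exists C, [/\ 0 <= C, Flip m I f = C%:E
    & forall i, sval (fl i) <= C].
  by apply: bigmaxe_fin => // i; case: (fl i) => c [].
have fFm i t : I i t -> `|(f i)^`(m)%classic t| <= Fm.
  move=> It; apply: le_trans (Fmle i); case: (fb i) => c [/= _ _]; exact.
have fF i s t : I i s -> I i t ->
    `|(f i)^`(m)%classic s - (f i)^`(m)%classic t| <= F * `|s - t|.
  move=> Is It; apply: (@le_trans _ _ (sval (fl i) * `|s - t|)).
    by case: (fl i) => c [/= _ _]; exact.
  by apply: ler_wpM2r.
pose coef v := xi_coef m x f theta v.
have mxi v : measurable_fun setT (fun w => lin (coef v) (rvec omega w)).
  exact: measurable_lin_rvec.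
pose xi v : {RV P >-> R} := HB.pack (fun w => lin (coef v) (rvec omega w))
  (isMeasurableFun.Build _ _ _ _ _ (mxi v)).
exists xi; split.
  move=> v Dv w.
  have id1 : \sum_(i < N) omega i w * f i (dotv (x i) v) =
      \sum_(k < m.+1) (k`!%:R)^-1 *
        (\sum_(i < N) omega i w * (f i)^`(k)%classic (dotv (x i) theta)
                         * dotv (x i) (v - theta) ^+ k)
         + xi v w * (wl1 x v theta) ^+ m.
    rewrite -[xi v w]/(lin (coef v) (rvec omega w)) /lin mulr_suml.
    under [X in _ + X]eq_bigr => i _.
      rewrite mulrAC xi_coefM// tnth_mktuple mulrC /taylor_rem mulrBr -dotvBr; over.
    rewrite sumrB addrCA -[LHS]addr0; congr (_ + _).
    under [X in X - _]eq_bigr do rewrite mulr_sumr.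
    rewrite exchange_big/= -sumrB big1// => i _; rewrite mulr_sumr -sumrB big1// => k _.
    by ring.
  split; first exact: id1.
  rewrite id1; congr (_ + _); apply: eq_bigr => k _; congr (_ * _).
  by rewrite dotv_suml; apply: eq_bigr => i _; rewrite dotvZl dotv_tensor_pow.
move=> q q01 E.
pose thr := threshold m I f x D0 sigma0 q.
have EE : E = [set w | exists2 v, D0 v & (thr < `|lin (coef v) (rvec omega w)|%:E)%E].
  apply/seteqP; split => w /=.
    by move=> /ereal_sup_gt[_ [v Dv <-] hv]; exists v.
  by move=> [v Dv hv]; apply: (lt_le_trans hv); apply: ereal_sup_ubound; exists v.
have E0 : (E = set0) -> measurable E /\ (P E <= q%:E)%E.
  by move=> ->; split => //; rewrite measure0 lee_fin; case/andP: q01 => /ltW.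
have Etau tau : thr = tau%:E -> E = exceed m omega x f D0 theta tau.
  by move=> thrE; rewrite EE thrE; apply/seteqP; split => w /= [v Dv hv]; exists v.
have V20 : 0 < scaled_moment x 2 by exact: moment_gt0.
have V0 : 0 < scaled_moment x (2 * m) by apply: moment_gt0 => //; rewrite oddM.
have S20 : 0 < Num.sqrt (scaled_moment x 2) by rewrite sqrtr_gt0.
have l2p : 0 < Num.sqrt (ln (2 * p)%:R) :> R.
  by rewrite sqrtr_gt0 ln_gt0// ltr1n (leq_trans _ (leq_pmulr 2 p_gt0)).
have mf0 k : k`!%:R != 0 :> R by rewrite pnatr_eq0 -lt0n fact_gt0.
pose ps := if m == 1%N then F / 2 else F / m`!%:R.
have psE : psi m I f = ps%:E.
  rewrite /psi /ps FE; case: ifP => _.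
    by rewrite inver pnatr_eq0/= -EFinM.
  by rewrite inver (negbTE (mf0 m)) -EFinM.
have diam v : D0 v -> ((wl1 x v theta)%:E <= wl1_diam x D0)%E.
  by move=> Dv; apply: ereal_sup_ubound; exists (v, theta).
have diam0 : (0 <= wl1_diam x D0)%E.
  by apply: le_trans (diam _ theta_D0); rewrite lee_fin; exact: wl1_ge0.
have Enull : (0 <= thr)%E ->
    (forall v, D0 v -> forall i, taylor_quot m (f i) (dotv (x i) theta) (dotv (x i) v) = 0) ->
    E = set0.
  move=> thr0 q0; rewrite EE -subset0 => w [v Dv] /=; rewrite ltNge.
  rewrite /lin big1 ?normr0 ?thr0// => i _.
  by rewrite /coef xi_coef_eq0 ?mul0r//; exact: q0.
have thrE : thr = (sigma0%:E * (8%:E * ps%:E * wl1_diam x D0 *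
    (Num.sqrt (scaled_moment x 2))%:E * (Num.sqrt (ln (2 * p)%:R))%:E +
    mine (2 * Fm / m`!%:R)%:E (F%:E * wl1_diam x D0 * (m.+1`!%:R^-1)%:E) *
      (Num.sqrt (scaled_moment x (2 * m)))%:E * (Num.sqrt (2 * ln (p%:R ^+ m / q)))%:E))%E.
  rewrite /thr /threshold /Aconst /Bconst /phi psE FE FmE !inver.
  by rewrite (negbTE (mf0 m)) (negbTE (mf0 m.+1)) -!EFinM.
have quot_lip v : D0 v -> forall i, `|taylor_quot m (f i) (dotv (x i) theta) (dotv (x i) v)|
    <= F / m.+1`!%:R * wl1 x v theta.
  by move=> Dv i; exact: (quot_le_lip d_gt0 cI DI theta_D0 f_diff F0 fF i Dv).
have quot_bd v : D0 v -> forall i, `|taylor_quot m (f i) (dotv (x i) theta) (dotv (x i) v)|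
    <= 2 * Fm / m`!%:R.
  by move=> Dv i; exact: (quot_le_bound cI DI theta_D0 f_diff Fm0 fFm i Dv).
(* [F = 0]: all quotients vanish, and so does the process, whatever the diameter *)
have [Fz|Fn0] := eqVneq F 0.
  apply/E0/Enull => [|v Dv i]; last first.
    by apply/eqP; rewrite -normr_le0; apply: (le_trans (quot_lip v Dv i)); rewrite Fz !mul0r.
  have ps0 : ps = 0 by rewrite /ps Fz !mul0r if_same.
  rewrite thrE ps0 Fz mule0 !mul0e add0e; apply: mule_ge0; first by rewrite lee_fin ltW.
  rewrite !mule_ge0 ?lee_fin ?sqrtr_ge0// le_min lexx andbT lee_fin.
  by rewrite divr_ge0 ?mulr_ge0.
have Fp : 0 < F by rewrite lt_neqAle eq_sym Fn0.
have psp : 0 < ps by rewrite /ps; case: ifP => _; rewrite divr_gt0// ltr0n fact_gt0.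
(* an infinite diameter makes the threshold infinite *)
move: diam diam0 thrE; case: (wl1_diam x D0) => [Q| |]// diam diam0 thrE; last first.
  apply: E0; rewrite EE -subset0 => w [v _] /=.
  have -> : thr = +oo%E.
    rewrite thrE -EFinM gt0_muley ?lte_fin ?mulr_gt0//.
    rewrite gt0_mulye ?lte_fin// gt0_mulye ?lte_fin//.
    rewrite gt0_muley ?lte_fin// gt0_mulye ?lte_fin ?invr_gt0 ?ltr0n ?fact_gt0//.
    rewrite (min_idPl _) ?leey// -!EFinM addye//.
    by rewrite gt0_muley// lte_fin.
  by rewrite ltNge leey.
have Q0 : 0 <= Q by rewrite -lee_fin.
pose ph := Num.min (2 * Fm / m`!%:R) (F * Q / m.+1`!%:R).
have ph0 : 0 <= ph by rewrite le_min !divr_ge0 ?mulr_ge0.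
have {}thrE : thr = (sigma0 * (8 * ps * Q * Num.sqrt (scaled_moment x 2) *
    Num.sqrt (ln (2 * p)%:R) +
    ph * Num.sqrt (scaled_moment x (2 * m)) * Num.sqrt (2 * ln (p%:R ^+ m / q))))%:E.
  by rewrite thrE /ph !(EFinM, EFinD, EFin_min).
have qph v : D0 v -> forall i,
    `|taylor_quot m (f i) (dotv (x i) theta) (dotv (x i) v)| <= ph.
  move=> Dv i; rewrite le_min quot_bd//=; apply: (le_trans (quot_lip v Dv i)).
  rewrite mulrAC; apply: ler_wpM2r; first by rewrite invr_ge0.
  by apply: ler_wpM2l => //; have := diam v Dv; rewrite lee_fin.
(* [phi = 0]: the variances vanish, and so does the process *)
have [phz|phn0] := eqVneq ph 0.
  apply/E0/Enull => [|v Dv i].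
    rewrite thrE lee_fin phz !mul0r addr0 !mulr_ge0//; exact: ltW.
  by apply/eqP; rewrite -normr_le0 -phz; exact: qph.
have php : 0 < ph by rewrite lt_neqAle eq_sym phn0.
rewrite (Etau _ thrE); split; first exact: measurable_exceed.
have wQ v : D0 v -> wl1 x v theta <= Q by move=> /diam; rewrite lee_fin.
apply: le_trans (exceed_prob omega_indep sigma0_gt0 gauss p_gt0 d_gt0 cI DI theta_D0
  f_diff F0 fF php Q0 qph wQ q01).
apply: le_measure; rewrite ?inE; [exact: measurable_exceed|exact: measurable_exceed|].
move=> w [v Dv hv]; exists v => //; apply: (le_lt_trans _ hv).
apply: threshold_le => //.
- exact: ltW.
- exact: lip_quot_le_psi.
- exact: lip_quot_ge0.
- exact: ltW.
- by rewrite ln_ge0// ler1n muln_gt0.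
Qed.
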